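(* Let $n,m$ be non-negative integers, and let $F_n^{[m]}$ be the clasped diagram of $m$ half twists on two strands coloured $n$. Then in the $A_1$ web space $$\langle F_n^{[m]}\rangle_2=(-1)^{mn}q^{-\frac m4(n^2+2n)}\sum_{0\le k_m\le\cdots\le k_1\le n}(-1)^{n-k_m}q^{\frac{n-k_m}{2}}(-1)^{\sum_{i=1}^mk_i}\,q^{\frac12\sum_{i=1}^m(k_i^2+k_i)}\binom{n}{k_1',k_2',\dots,k_m',k_m}_q\ \langle E_{k_m}\rangle_2,$$ where $k_0=n$ and $k_{i+1}'=k_i-k_{i+1}$ for $i=0,1,\dots,m-1$. Here $F_n^{[m]}$ and $E_k$ are the diagrams described in the context.
   Context: **Quantum notation.** $[k]=\frac{q^{k/2}-q^{-k/2}}{q^{1/2}-q^{-1/2}}$, $(q)_k=\prod_{l=1}^k(1-q^l)$, and $\binom{n}{n_1,\dots,n_r}_q=\frac{(q)_n}{(q)_{n_1}\cdots(q)_{n_r}}$ for $n_1+\dots+n_r=n$. For $m=0$ the sum consists of the single term with $k_0=n$. **$A_1$ webs and Kauffman bracket.** For a disk with marked boundary points, the $A_1$ web space is the $\mathbb{Q}(q^{1/4})$-vector space with basis the boundary-fixing isotopy classes of crossingless systems of arcs whose endpoints are exactly the marked points. The Kauffman bracket $\langle\cdot\rangle_2$ maps linear combinations of (unoriented) tangle diagrams to this space by the rules: a crossing whose overstrand runs from lower left to upper right equals $q^{1/4}$ times the smoothing joining upper left to lower left and upper right to lower right, plus $q^{-1/4}$ times the smoothing joining upper left to upper right and lower left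 to lower right; a disjoint trivial circle is removed with the factor $-[2]$. **Clasps (Jones-Wenzl idempotents).** $P_n$ has $n$ ends on the left and $n$ on the right: $P_1$ is a strand and $P_n=(P_{n-1}\sqcup1)+\frac{[n-1]}{[n]}(P_{n-1}\sqcup1)(\mathrm{id}_{n-2}\sqcup U)(P_{n-1}\sqcup1)$, where $\sqcup1$ adds one strand below, products are horizontal concatenation, and $U$ is the diagram joining the two lowest left ends by an arc and the two lowest right ends by an arc. $P_0$ is empty. **The diagrams.** Work in a rectangle with four groups of $n$ boundary points: NW, SW (upper, lower group on the left side) and NE, SE (upper, lower group on the right side). In both diagrams below a clasp $P_n$ is inserted at each of the four groups. - $F_n^{[m]}$: two horizontal strands twisted about each other with $m$ crossings in a horizontal row, where at each crossing the strand descending from upper left to lower right passes over; each of the two strands is then replaced by $n$ parallel copies. - $E_k$ ($0\le k\le n$): the $k$ uppermost strands at NW run straight to the $k$ uppermost at NE, the $k$ lowermost strands at SW run straight to the $k$ lowermost at SE, the remaining $n-k$ strands at NW are joined to the remaining ones at SW by nested arcs, and the remaining $n-k$ strands at NE are joined to the remaining ones at SE by nested arcs. *)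

(* Defs.v *)
From HB Require Import structures.
From mathcomp Require Import all_boot all_order all_algebra.
From mathcomp Require Import zify.

Set Implicit Arguments.
Unset Strict Implicit.
Unset Printing Implicit Defensive.

Import GRing.Theory.
Local Open Scope ring_scope.

(* The field Q(q^{1/4}): the indeterminate is q^{1/4}. *)
Notation Kq := {fraction {poly rat}}.

Definition q14 : Kq := tofrac ('X : {poly rat}).
Definition q12 : Kq := q14 ^+ 2.
Definition q : Kq := q14 ^+ 4.

(* [k] *)
Definition qint (k : nat) : Kq := (q12 ^+ k - q12 ^- k) / (q12 - q12^-1).

(* (q)_k *)
Definition qpoch (k : nat) : Kq := \prod_(1 <= l < k.+1) (1 - q ^+ l).

(* binom(n; n_1, ..., n_r)_q for s = [:: n_1; ...; n_r] with sumn s = n *)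
Definition qmultinom (n : nat) (s : seq nat) : Kq :=
  qpoch n / \prod_(j <- s) qpoch j.

(* A crossingless system of arcs in a disk with N marked boundary points,
   labelled 0, ..., N-1 along the boundary, is up to isotopy its noncrossing
   perfect matching: f sends each marked point to the other end of its arc. *)
Definition noncrossing (N : nat) (f : {ffun 'I_N -> 'I_N}) : bool :=
  [forall x, (f x != x) && (f (f x) == x)] &&
  [forall x : 'I_N, forall y : 'I_N,
     ~~ [&& (x < y)%N, (y < f x)%N & (f x < f y)%N]].

Notation arcs N := {f : {ffun 'I_N -> 'I_N} | noncrossing f}.
Notation web N := {ffun arcs N -> Kq^o}.

(* A matching under construction is a partner function on labels; its values
   at labels >= N are irrelevant. *)
Definition basis (N : nat) (p : nat -> nat) : web N :=
  [ffun w : arcs N => [forall x : 'I_N, val w x == p x :> nat]%:R].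

(* Tangle diagrams in a rectangle are read from left to right as a sequence of
   elementary slices.  Strands are numbered 0, 1, ... from the top, and
   - Cross d i : strands i and i+1 cross; the strand descending from upper left
                 to lower right is over if d = true, and under otherwise;
   - Close i   : strands i and i+1 are joined by an arc and end;
   - Open i    : an arc is born, whose ends become strands i and i+1. *)
Variant slice := Cross of bool & nat | Close of nat | Open of nat.

Definition diagram := seq slice.

(* The number of right ends of a diagram with a left ends, if it is legal. *)
Fixpoint right_ends (a : nat) (w : diagram) : option nat :=
  match w with
  | [::] => Some a
  | Cross _ i :: w' => if (i.+1 < a)%N then right_ends a w' else None
  | Close i :: w' => if (i.+1 < a)%N then right_ends a.-2 w' else None
  | Open i :: w' => if (i <= a)%N then right_ends a.+2 w' else None
  end.

Definition skip2 (i x : nat) : nat := if (x < i)%N then x else x.+2.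
Definition unskip2 (i x : nat) : nat := if (x < i)%N then x else x.-2.

(* The boundary of the rectangle is labelled clockwise from the upper right
   corner: if there are b right and a left ends, the right ends are 0, ..., b-1
   from top to bottom and the left ends are b, ..., b+a-1 from bottom to top.
   Thus appending a slice at the right acts on the labels i, i+1 themselves. *)
Definition open_arc (i : nat) (p : nat -> nat) : nat -> nat := fun x =>
  if x == i then i.+1 else if x == i.+1 then i else skip2 i (p (unskip2 i x)).

Definition close_arc (i : nat) (p : nat -> nat) : nat -> nat := fun x =>
  let y := p (skip2 i x) in
  unskip2 i (if y == i then p i.+1 else if y == i.+1 then p i else y).

(* Closing i, i+1 creates a trivial circle exactly when they are the two ends
   of one arc. *)
Definition circle_factor (i : nat) (p : nat -> nat) : Kq :=
  if p i == i.+1 then - qint 2 else 1.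

(* a left ends joined straight to a right ends *)
Definition through (a : nat) : nat -> nat := fun x => ((2 * a).-1 - x)%N.

(* The skein rules, applied slice by slice to a crossingless system p already
   drawn to the left.  With the overstrand from lower left to upper right
   (d = false), the smoothing )( has coefficient q^{1/4} and the two horizontal
   strands have q^{-1/4}; for d = true the same rule, seen after a quarter turn,
   exchanges the coefficients. *)
Fixpoint resolve (N : nat) (w : diagram) (p : nat -> nat) : web N :=
  match w with
  | [::] => basis N p
  | Cross d i :: w' =>
      (if d then q14 else q14^-1) *: resolve N w' p +
      (if d then q14^-1 else q14) *:
        (circle_factor i p *: resolve N w' (open_arc i (close_arc i p)))
  | Close i :: w' => circle_factor i p *: resolve N w' (close_arc i p)
  | Open i :: w' => resolve N w' (open_arc i p)
  end.

(* formal linear combinations of diagrams *)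
Definition lincomb := seq (Kq * diagram).

Definition dg (w : diagram) : lincomb := [:: (1, w)].
Definition lscale (c : Kq) (x : lincomb) : lincomb :=
  [seq (c * s.1, s.2) | s <- x].
Definition lcomp (x y : lincomb) : lincomb :=
  [seq (s.1 * r.1, s.2 ++ r.2) | s <- x, r <- y].

(* As strands are numbered from the top, a diagram with strands added below it
   is given by the same slices; d strands are added above it by [below d]. *)
Definition shift_slice (d : nat) (s : slice) : slice :=
  match s with
  | Cross o i => Cross o (d + i)
  | Close i => Close (d + i)
  | Open i => Open (d + i)
  end.
Definition below (d : nat) (x : lincomb) : lincomb :=
  [seq (s.1, [seq shift_slice d e | e <- s.2]) | s <- x].

(* The Kauffman bracket of combinations of diagrams with a left and b right
   ends. *)
Definition bracket (a b : nat) (x : lincomb) : web (b + a) :=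
  \sum_(s <- x) s.1 *: resolve (b + a) s.2 (through a).

Fixpoint clasp (n : nat) : lincomb :=
  if n isn't n1.+1 then dg [::] else
  if n1 isn't n2.+1 then dg [::] else
  let P := clasp n1 in
  P ++ lscale (qint n1 / qint n)
         (lcomp P (lcomp (dg [:: Close n2; Open n2]) P)).

Definition two_clasps (n : nat) : lincomb :=
  lcomp (clasp n) (below n (clasp n)).

Definition clasped (n : nat) (w : diagram) : lincomb :=
  lcomp (two_clasps n) (lcomp (dg w) (two_clasps n)).

(* d nested arcs joining strands i, ..., i+d-1 to i+d, ..., i+2d-1 *)
Definition nested_close (i d : nat) : diagram :=
  [seq Close j | j <- rev (iota i d)].
Definition nested_open (i d : nat) : diagram :=
  [seq Open j | j <- iota i d].

(* Replaces every strand by n parallel copies.  At a crossing, the copies of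
   the lower strand cross the copies of the upper one after the other, each
   going up from position n*i+n+j to n*i+j. *)
Definition cable_slice (n : nat) (s : slice) : diagram :=
  match s with
  | Cross o i =>
      [seq Cross o (n * i + (n + j).-1 - l) | j <- iota 0 n, l <- iota 0 n]
  | Close i => nested_close (n * i) n
  | Open i => nested_open (n * i) n
  end.
Definition cable (n : nat) (w : diagram) : diagram :=
  flatten [seq cable_slice n s | s <- w].

Definition twist (m : nat) : diagram := nseq m (Cross true 0).

Definition F (n m : nat) : lincomb := clasped n (cable n (twist m)).

Definition E (n k : nat) : lincomb :=
  clasped n (nested_close k (n - k) ++ nested_open k (n - k)).

(* Well-formedness: the diagrams above are legal, and the partner functions met
   by [resolve] are noncrossing matchings, so that [basis] is applied only to
   elements of the basis. *)

Definition legal (a b : nat) (x : lincomb) : bool :=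
  all (fun s => right_ends a s.2 == Some b) x.

Lemma right_ends_cat a w1 w2 :
  right_ends a (w1 ++ w2) = obind (right_ends^~ w2) (right_ends a w1).
Proof. by elim: w1 a => //= -[d i|i|i] w IH a; case: ifP. Qed.

Lemma legal_comp a b c x y :
  legal a b x -> legal b c y -> legal a c (lcomp x y).
Proof.
rewrite /legal => + hy; elim: x => //= s x IH /andP[/eqP hs /IH {}IH].
rewrite all_cat IH andbT all_map; apply: sub_all hy => r /= /eqP hr.
by rewrite right_ends_cat hs /= hr.
Qed.

Lemma right_ends_add a b c w :
  right_ends a w = Some b -> right_ends (a + c) w = Some (b + c)%N.
Proof.
elim: w a => [|[d i|i|i] w IH] a /=; first by case=> ->.
- by case: ifP => // h /IH; rewrite ifT //; lia.
- case: ifP => // h /IH; rewrite ifT; last by lia.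
  by have -> : (a.-2 + c = (a + c).-2)%N by lia.
- by case: ifP => // h /IH; rewrite ifT //; lia.
Qed.

Lemma right_ends_shift a b c w : right_ends a w = Some b ->
  right_ends (c + a) [seq shift_slice c e | e <- w] = Some (c + b)%N.
Proof.
elim: w a => [|[d i|i|i] w IH] a /=; first by case=> ->.
- by case: ifP => // h /IH; rewrite ifT //; lia.
- case: ifP => // h /IH; rewrite ifT; last by lia.
  by have -> : (c + a.-2 = (c + a).-2)%N by lia.
- by case: ifP => // h /IH; rewrite !addnS ifT //; lia.
Qed.

Lemma legal_add a b c x : legal a b x -> legal (a + c) (b + c) x.
Proof. by apply: sub_all => s /eqP hs; apply/eqP/right_ends_add. Qed.

Lemma legal_below a b c x : legal a b x -> legal (c + a) (c + b) (below c x).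
Proof.
rewrite /legal all_map; apply: sub_all => s /eqP hs.
by apply/eqP/right_ends_shift.
Qed.

Lemma legal_clasp n : legal n n (clasp n).
Proof.
elim: n => // -[//|n] IH.
have H : legal n.+2 n.+2 (clasp n.+1).
  by have := legal_add 1 IH; rewrite addn1.
have HU : legal n.+2 n.+2 (dg [:: Close n; Open n]).
  by rewrite /legal /= ltnSn leqnn eqxx.
have := legal_comp H (legal_comp HU H).
by move: H; rewrite [clasp n.+2]/= /legal all_cat all_map => -> h.
Qed.

Lemma legal_clasped n w : right_ends (n + n) w = Some (n + n)%N ->
  legal (n + n) (n + n) (clasped n w).
Proof.
move=> hw.
have H : legal (n + n) (n + n) (two_clasps n).
  apply: (@legal_comp _ (n + n)); first exact/legal_add/legal_clasp.
  exact/legal_below/legal_clasp.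
apply: (legal_comp H); apply: (legal_comp _ H).
by rewrite /legal /= hw eqxx.
Qed.

Lemma legal_F n m : legal (n + n) (n + n) (F n m).
Proof.
apply: legal_clasped.
have hx s : all (fun i => i.+1 < n + n)%N s ->
    right_ends (n + n) [seq Cross true i | i <- s] = Some (n + n)%N.
  by elim: s => //= i s IH /andP[-> /IH].
have hs : right_ends (n + n) (cable_slice n (Cross true 0)) = Some (n + n)%N.
  have -> : cable_slice n (Cross true 0) = [seq Cross true i |
      i <- [seq (n * 0 + (n + j).-1 - l)%N | j <- iota 0 n, l <- iota 0 n]].
    by rewrite map_allpairs.
  apply/hx/allP => z /allpairsP[[j l] [/= + + ->]].
  by rewrite !mem_iota; lia.
by elim: m => //= m IH; rewrite /cable /= right_ends_cat hs.
Qed.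

Lemma legal_E n k : (k <= n)%N -> legal (n + n) (n + n) (E n k).
Proof.
move=> kn; apply: legal_clasped.
have hc d : right_ends ((k + d) + (k + d)) (nested_close k d)
    = Some (k + k)%N.
  elim: d => [|d IH]; first by rewrite addn0.
  have -> : nested_close k d.+1 = Close (k + d) :: nested_close k d.
    by rewrite /nested_close -[in LHS]addn1 iotaD /= cats1 rev_rcons.
  rewrite /= ifT; last by lia.
  by have -> : ((k + d.+1 + (k + d.+1)).-2 = k + d + (k + d))%N by lia.
have ho d j : (j <= k + k)%N ->
    right_ends (k + k) (nested_open j d) = Some (k + k + 2 * d)%N.
  have : forall a, (j <= a)%N ->
      right_ends a (nested_open j d) = Some (a + 2 * d)%N.
    elim: d j => [|d IH] i a ia /=; first by rewrite addn0.
    by rewrite ia IH; [congr Some; lia | lia].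
  by apply.
rewrite right_ends_cat; have := hc (n - k)%N; rewrite subnKC // => -> /=.
by rewrite ho; [congr Some; lia | lia].
Qed.

Definition planar (N : nat) (p : nat -> nat) : Prop :=
  (forall x, (x < N)%N -> [/\ (p x < N)%N, p x <> x & p (p x) = x]) /\
  (forall x y, (y < N)%N -> (x < y)%N -> (y < p x)%N -> (p x < p y)%N -> False).

Lemma skip2_neq i z : (skip2 i z != i) && (skip2 i z != i.+1).
Proof. by rewrite /skip2; case: ltnP; lia. Qed.

Lemma skip2K i : cancel (skip2 i) (unskip2 i).
Proof.
move=> z; rewrite /skip2 /unskip2; case: (ltnP z i) => [-> //|h].
by rewrite ifF //; lia.
Qed.

Lemma unskip2K i z : z <> i -> z <> i.+1 -> skip2 i (unskip2 i z) = z.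
Proof.
rewrite /skip2 /unskip2 => z1 z2; case: (ltnP z i) => [-> //|h].
by rewrite ifF; lia.
Qed.

Lemma planar_through a : planar (a + a) (through a).
Proof. by split; rewrite /through => *; [split|]; lia. Qed.

Lemma planar_open N i p :
  (i <= N)%N -> planar N p -> planar N.+2 (open_arc i p).
Proof.
move=> iN [hp hc]; split=> [x xN|x y yN xy].
  have := hp (unskip2 i x); rewrite /open_arc.
  case: (eqVneq x i) => [->|xi] hx; first by rewrite eqxx gtn_eqF //; split; lia.
  case: (eqVneq x i.+1) => [->|xi1] in hx *; first by rewrite eqxx; split; lia.
  have {}hx : (unskip2 i x < N)%N by rewrite /unskip2; case: ifP; lia.
  have [h1 h2 h3] := hp _ hx.
  have hs z : skip2 i z != i /\ skip2 i z != i.+1 /\ unskip2 i (skip2 i z) = z.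
    by have /andP[] := skip2_neq i z; rewrite skip2K.
  have hu : skip2 i (unskip2 i x) = x.
    by apply: unskip2K; apply/eqP.
  have [/negPf -> [/negPf -> ->]] := hs (p (unskip2 i x)).
  rewrite h3 hu; split=> //; first by rewrite /skip2; case: ifP; lia.
  move=> e; apply: h2; rewrite -[LHS](hs _).2.2 e //.
have hx := hp (unskip2 i x); have hy := hp (unskip2 i y).
have := hc (unskip2 i x) (unskip2 i y).
move: hx hy; rewrite /open_arc.
case: (eqVneq x i) => [?|xi]; first by lia.
case: (eqVneq x i.+1) => [?|xi1]; first by lia.
case: (eqVneq y i) => [?|yi]; first by rewrite /skip2; case: ifP; lia.
case: (eqVneq y i.+1) => [?|yi1]; first by rewrite /skip2; case: ifP; lia.
rewrite /skip2; case: ifP; case: ifP; rewrite /unskip2; case: ifP; case: ifP; lia.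
Qed.

Lemma planar_close N i p :
  (i.+1 < N.+2)%N -> planar N.+2 p -> planar N (close_arc i p).
Proof.
move=> iN [hp hc].
have hs z : skip2 i z != i /\ skip2 i z != i.+1 /\ unskip2 i (skip2 i z) = z.
  by have /andP[] := skip2_neq i z; rewrite skip2K.
have hu z : z <> i -> z <> i.+1 -> skip2 i (unskip2 i z) = z.
  exact: unskip2K.
have hN z : (skip2 i z < N.+2)%N = (z < N)%N.
  by rewrite /skip2; case: ifP; lia.
have hmono y z : (skip2 i y < skip2 i z)%N = (y < z)%N.
  by rewrite /skip2; case: ifP; case: ifP; lia.
pose c x := if p x == i then p i.+1 else if p x == i.+1 then p i else p x.
have hcl x : close_arc i p x = unskip2 i (c (skip2 i x)) by [].
have [i1 i2 i3] := hp i (ltnW iN).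
have [j1 j2 j3] := hp i.+1 iN.
have cP x : (x < N.+2)%N -> x <> i -> x <> i.+1 ->
    [/\ (c x < N.+2)%N, c x <> i, c x <> i.+1, c x <> x & c (c x) = x].
  move=> xN xi xj; have [x1 x2 x3] := hp x xN; rewrite /c.
  case: (eqVneq (p x) i) => [e|e].
    have e' : p i = x by rewrite -e.
    have n1 : p i.+1 <> i by move=> h; rewrite h in j3; lia.
    have n2 : p i.+1 <> x by move=> h; rewrite h e in j3; lia.
    by rewrite j3 eqxx gtn_eqF.
  case: (eqVneq (p x) i.+1) => [e2|e2].
    have e' : p i.+1 = x by rewrite -e2.
    have n1 : p i <> i.+1 by move=> h; rewrite h in i3; lia.
    have n2 : p i <> x by move=> h; rewrite h e2 in i3; lia.
    by rewrite i3 eqxx.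
  by rewrite x3; do 2 (case: eqP => // _); split=> //; apply/eqP.
have skip_c x : (x < N)%N -> skip2 i (close_arc i p x) = c (skip2 i x).
  move=> xN; have [s1 [s2 _]] := hs x.
  have [||| _ h1 h2 _ _] := cP (skip2 i x); rewrite ?hN //; [exact/eqP|exact/eqP|].
  by rewrite hcl hu.
split=> [x xN|x y yN xy h1 h2].
  have [s1 [s2 s3]] := hs x.
  have [||| c1 c2 c3 c4 c5] := cP (skip2 i x); rewrite ?hN //; [exact/eqP|exact/eqP|].
  split; first by rewrite -hN skip_c.
    by move=> h; apply: c4; rewrite -skip_c // h.
  by rewrite hcl skip_c // c5 s3.
have xN : (x < N)%N by lia.
move: xy h1 h2; rewrite -(hmono x y) -(hmono y (close_arc i p x)).
rewrite -(hmono (close_arc i p x)) !skip_c //.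
have [/eqP sx1 [/eqP sx2 _]] := hs x; have [/eqP sy1 [/eqP sy2 _]] := hs y.
move: xN yN; rewrite -!hN => xN yN.
move: (skip2 i x) (skip2 i y) sx1 sx2 sy1 sy2 xN yN.
move=> {}x {}y sx1 sx2 sy1 sy2 xN yN xy.
have [x1 x2 x3] := hp x xN; have [y1 y2 y3] := hp y yN.
rewrite /c.
have iN' := ltnW iN; have hxy := hc x y yN.
case: (eqVneq (p x) i) => [e|/eqP e].
  rewrite e in x3 hxy; case: (eqVneq (p y) i) => [e'|/eqP e'].
    by rewrite e' in y3; lia.
  case: (eqVneq (p y) i.+1) => [e2|/eqP e2]; first by rewrite e2 in y3; lia.
  have h1 := hc y (p i.+1) j1; rewrite j3 in h1; have h2 := hc i.+1 y yN.
  by clear -xy sx1 sx2 sy1 sy2 e' e2 hxy h1 h2; lia.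
case: (eqVneq (p x) i.+1) => [e1|/eqP e1].
  rewrite e1 in x3 hxy; case: (eqVneq (p y) i) => [e'|/eqP e'].
    by rewrite e' in y3; lia.
  case: (eqVneq (p y) i.+1) => [e2|/eqP e2]; first by rewrite e2 in y3; lia.
  have h1 := hc y (p i) i1; rewrite i3 in h1; have h2 := hc i y yN.
  by clear -xy sx1 sx2 sy1 sy2 e' e2 hxy h1 h2; lia.
case: (eqVneq (p y) i) => [e'|/eqP e'].
  rewrite e' in y3 hxy; have h1 := hc x i.+1 iN; have h2 := hc i i.+1 iN.
  rewrite y3 in h2.
  by clear -xy sx1 sx2 sy1 sy2 e e1 hxy h1 h2; lia.
case: (eqVneq (p y) i.+1) => [e2|/eqP e2].
  rewrite e2 in y3 hxy; have h1 := hc x i iN'; have h2 := hc i.+1 x xN.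
  rewrite y3 in h2.
  by clear -xy sx1 sx2 sy1 sy2 e e1 hxy h1 h2; lia.
by clear -xy hxy; lia.
Qed.

Lemma basis_planar N p : planar N p ->
  exists u : arcs N, basis N p = [ffun w : arcs N => (w == u)%:R].
Proof.
move=> [hp hc].
have hN (x : 'I_N) : (p x < N)%N by case: (hp x (ltn_ord x)).
pose f : {ffun 'I_N -> 'I_N} := [ffun x : 'I_N => Ordinal (hN x)].
have fE x : f x = p x :> nat by rewrite ffunE.
have fP : noncrossing f.
  apply/andP; split; apply/forallP => x.
    have [_ h1 h2] := hp x (ltn_ord x).
    by rewrite -!val_eqE /= !fE h2 eqxx andbT; apply/eqP.
  apply/forallP => y; apply/negP; rewrite !fE => /and3P[h1 h2 h3].
  exact: (hc x y).
exists (exist _ f fP); apply/ffunP => w; rewrite !ffunE.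
congr ((nat_of_bool _)%:R); apply/forallP/eqP => [h|-> x]; last first.
  by rewrite /= fE.
by apply/val_inj/ffunP => x; apply/val_inj; rewrite /= fE; exact/eqP.
Qed.

(* Main.v *)
Require Import Defs.
From HB Require Import structures.
From mathcomp Require Import all_boot all_order all_algebra.
From mathcomp Require Import zify ring.
From mathcomp Require Import boolp functions.

Set Implicit Arguments.
Unset Strict Implicit.
Unset Printing Implicit Defensive.

Import GRing.Theory.
Local Open Scope ring_scope.

(** Cut a diagram into slices, from left to right. A slice that closes or
    opens an arc acts on the functions of crossingless systems, by looking at
    what the system drawn to its left becomes; so a diagram is a product of
    operators C_i (close) and O_i (open), in which everything to its right is
    a vector v and everything to its left a linear map x. These operators
    satisfy the Temperley-Lieb relations: O_i C_i is minus the quantum integer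
    two, O_i C_(i+1) and O_(i+1) C_i are the identity, and distant slices
    commute. A crossing is a + a^-1 C_i O_i with a = q^(1/4).

    The clasps enter only through one property ([two_jw_free],
    [two_jw_cofree]): they kill a turnback inside either group of n strands,
    that is, x C_i = 0 and O_i v = 0 unless the positions i, i+1 straddle the
    two groups. For any such x and v the argument has two steps.

    One crossing of cables ([twine_sum]). In the crossing of n strands over n
    strands, smooth the crossings of the highest lower strand with the n upper
    ones, then those of one upper strand with the n-1 remaining lower ones.
    Every mixed smoothing creates a killed turnback, so only two terms survive
    ([twine_expand]): all 2n-1 crossings are smoothed horizontally, with
    coefficient a^(2n-1), or all vertically, with coefficient a^-(2n-1). Both
    leave a crossing of n-1 strands over n-1 strands. The recursion is the
    Pascal rule of the q-binomial coefficients up to powers of a, whence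
    coefficients a^(2k^2-n^2) binom(n,k)_q on the diagram with n-k turnbacks.

    A turnback before a crossing ([opens_twine]). The innermost of the n-k
    arcs that E_k opens to the right passes through the following crossing of
    cables: its own curl gives -a^-3 and each of the other strands it crosses
    gives a^-1, because all other smoothings are killed. Removing the arcs one
    after the other turns the crossing of n-cables into one of k-cables.

    With k = k_1 chosen at the first crossing, the remaining m-1 crossings
    become crossings of k_1-cables, and induction on m ([twists_sum]) gives a
    sum over n >= k_1 >= ... >= k_m. The binomials of a chain telescope to the
    multinomial coefficient, and the powers of a and the signs collect to the
    stated ones ([weightE]). *)

(** * Quantum numbers, binomials and the coefficients *)

Lemma sorted_geq_last n s : sorted geq (n :: s) -> (last n s <= n)%N.
Proof.
elim: s n => //= k s IH n /andP[kn /IH]; move: kn; rewrite /geq; lia.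
Qed.

(** The scalar identities hold in any field for an element [a] that is not a
    root of unity. It stands for q^(1/4), so q^(1/2) is [a ^+ 2] and q is [a
    ^+ 4]. *)
Section Scalars.
Variables (K : fieldType) (a : K).
Hypothesis aX_neq1 : forall n, (0 < n)%N -> a ^+ n != 1.
Hypothesis a_neq0 : a != 0.

Definition qnum n : K := ((a ^+ 2) ^+ n - (a ^+ 2) ^- n) / (a ^+ 2 - a ^- 2).
Definition qfac n : K := \prod_(1 <= l < n.+1) (1 - (a ^+ 4) ^+ l).

Lemma qnum_num_neq0 n : (0 < n)%N -> (a ^+ 2) ^+ n - (a ^+ 2) ^- n != 0.
Proof.
move=> n0; have h : (a ^+ 2) ^+ n != 0 by rewrite !expf_neq0.
apply: contra (aX_neq1 (n := 2 * n * 2) _); last by lia.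
by rewrite subr_eq0 => /eqP e; rewrite exprM exprM expr2 {1}e mulVf.
Qed.

Lemma qnum_den_neq0 : a ^+ 2 - a ^- 2 != 0.
Proof. exact: (qnum_num_neq0 (n := 1)). Qed.

Lemma qnum_neq0 n : (0 < n)%N -> qnum n != 0.
Proof.
by move=> n0; rewrite mulf_neq0 ?invr_neq0 ?qnum_num_neq0 ?qnum_den_neq0.
Qed.

Lemma qnum1 : qnum 1 = 1.
Proof. exact: divff qnum_den_neq0. Qed.

Lemma qnum2 : qnum 2 = a ^+ 2 + a ^- 2.
Proof.
by apply: (mulIf qnum_den_neq0); rewrite divfK ?qnum_den_neq0 //; field.
Qed.

Lemma qnum_rec n : qnum n.+2 = qnum 2 * qnum n.+1 - qnum n.
Proof.
have h := qnum_den_neq0; rewrite qnum2; apply: (mulIf h).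
rewrite /qnum [RHS]mulrBl -[_ * (_ / _) * _]mulrA !divfK //.
rewrite -!exprM !mulnS !exprD.
by field; rewrite !expf_neq0.
Qed.

Lemma qfacS n : qfac n.+1 = qfac n * (1 - (a ^+ 4) ^+ n.+1).
Proof. by rewrite /qfac big_nat_recr. Qed.

Lemma qfac_neq0 n : qfac n != 0.
Proof.
elim: n => [|n IH]; first by rewrite /qfac big_geq ?oner_eq0.
by rewrite qfacS mulf_neq0 // subr_eq0 eq_sym -exprM aX_neq1.
Qed.

(** This form of the Pascal rule is the one that matches the expansion of a
    crossing of cables: [qbin n' k] counts the states with one more turnback,
    [qbin n' k'] those with one more straight pair. *)
Fixpoint qbin n k : K :=
  match n, k with
  | _, 0 => 1
  | 0, _.+1 => 0
  | n'.+1, k'.+1 => qbin n' k + (a ^+ 4) ^+ (n' - k') * qbin n' k'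
  end.

Lemma qbin_small n k : (n < k)%N -> qbin n k = 0.
Proof.
by elim: n k => [|n IH] [|k] //= nk; rewrite !IH ?mulr0 ?addr0 //; lia.
Qed.

Lemma qbin_qfac n k :
  (k <= n)%N -> qbin n k * (qfac k * qfac (n - k)) = qfac n.
Proof.
have f0 : qfac 0 = 1 by rewrite /qfac big_geq.
elim: n k => [|n IH] [|k] // kn; rewrite ?f0 ?mul1r ?subn0 //= ?mul1r //.
rewrite subSS !qfacS mulrDl; move: kn.
rewrite ltnS leq_eqVlt => /predU1P[->|kn].
  rewrite qbin_small // subnn f0 mul0r add0r expr0 mul1r mulr1.
  by rewrite mulrA -{2}(IH n) // subnn f0 mulr1.
have e1 := IH k.+1 kn; have e2 := IH k (ltnW kn).
have e : (n - k = (n - k.+1).+1)%N by lia.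
rewrite -{1}e2 mulrDr mulr1.
rewrite e qfacS -e in e2 *; rewrite qfacS in e1.
transitivity
  (qbin n k.+1 * (qfac k * (1 - (a ^+ 4) ^+ k.+1) * qfac (n - k.+1)) *
     (1 - (a ^+ 4) ^+ (n - k)) +
   (a ^+ 4) ^+ (n - k) * (1 - (a ^+ 4) ^+ k.+1) *
     (qbin n k * (qfac k * (qfac (n - k.+1) * (1 - (a ^+ 4) ^+ (n - k)))))).
  by ring.
rewrite e1 e2.
have -> : (a ^+ 4) ^+ n.+1 = (a ^+ 4) ^+ (n - k) * (a ^+ 4) ^+ k.+1.
  by rewrite -exprD; congr (_ ^+ _); lia.
by ring.
Qed.

(** The coefficient of the diagram with [n - k] turnbacks in the crossing of
    two clasped n-cables. *)
Definition crossing_coef n k : K := a ^+ (2 * k ^ 2) / a ^+ (n ^ 2) * qbin n k.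

Lemma crossing_coef00 : crossing_coef 0 0 = 1.
Proof. by rewrite /crossing_coef /= expr0 mulr1 divr1. Qed.

Lemma crossing_coef_small n k : (n < k)%N -> crossing_coef n k = 0.
Proof. by move=> nk; rewrite /crossing_coef qbin_small ?mulr0. Qed.

Lemma crossing_coef0 n :
  crossing_coef n.+1 0 = a ^- (2 * n + 1) * crossing_coef n 0.
Proof.
rewrite /crossing_coef muln0 !expr0 !mul1r.
have -> : (n.+1 ^ 2 = 2 * n + 1 + n ^ 2)%N by lia.
have -> : qbin n 0 = 1 by case: (n).
by rewrite !mulr1 exprD invfM.
Qed.

Lemma crossing_coef_pascal n k : crossing_coef n.+1 k.+1 =
  a ^- (2 * n + 1) * crossing_coef n k.+1 +
  a ^+ (2 * n + 1) * crossing_coef n k.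
Proof.
case: (ltnP n k) => nk.
  by rewrite !crossing_coef_small ?mulr0 ?addr0 //; lia.
rewrite /crossing_coef /= mulrDr; congr (_ + _).
  have -> : (n.+1 ^ 2 = 2 * n + 1 + n ^ 2)%N by lia.
  by rewrite exprD invfM !mulrA [_^-1 * a ^+ (2 * _)]mulrC.
rewrite !mulrA; congr (_ * _).
have hn := expf_neq0 (n ^ 2) a_neq0; have hS := expf_neq0 (n.+1 ^ 2) a_neq0.
rewrite mulrAC; apply/eqP; rewrite eqr_div // -!exprM -!exprD.
by apply/eqP; congr (_ ^+ _); nia.
Qed.

(** The factor produced when [n - k] nested arcs are pulled through the
    crossing of two clasped n-cables, which becomes a crossing of k-cables. It
    is the ratio of the framing factors (-1)^n a^-(n^2+2n) of a full curl of
    the clasped cable. *)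
Definition curl_coef n k : K :=
  (-1) ^+ (n - k) * a ^+ (k ^ 2 + 2 * k) / a ^+ (n ^ 2 + 2 * n).

Lemma curl_coef_nn n : curl_coef n n = 1.
Proof. by rewrite /curl_coef subnn mul1r divff ?expf_neq0. Qed.

(** The exponent [2 * n + 3] is 3 for the self-crossing of the innermost arc
    and 1 for each of the [2 * n] other strands that it crosses. *)
Lemma curl_coefS n k :
  (k <= n)%N -> - a ^- (2 * n + 3) * curl_coef n k = curl_coef n.+1 k.
Proof.
move=> kn; rewrite /curl_coef subSn // exprS.
have -> : (n.+1 ^ 2 + 2 * n.+1 = 2 * n + 3 + (n ^ 2 + 2 * n))%N by nia.
rewrite (exprD _ (2 * n + 3)) invfM mulN1r !mulNr; congr (- _).
by rewrite mulrCA.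
Qed.

(** The exponent [size s'] is the number of crossings still ahead when the
    first one has left [n - k] turnbacks: the arcs curl once through each of
    them. *)
Fixpoint weight n (s : seq nat) : K :=
  if s is k :: s' then
    crossing_coef n k * curl_coef n k ^+ size s' * weight k s'
  else 1.

Definition qmult n (s : seq nat) : K := qfac n / \prod_(j <- s) qfac j.

Definition gaps n s :=
  rcons [seq nth 0 (n :: s) i - nth 0 (n :: s) i.+1 | i <- iota 0 (size s)]%N
    (last n s).

Lemma gaps_cons n k s : gaps n (k :: s) = (n - k)%N :: gaps k s.
Proof. by rewrite /gaps /= (iotaDl 1 0) -map_comp. Qed.

Lemma qmult_cons n k s : (k <= n)%N ->
  qmult n ((n - k)%N :: s) = qbin n k * qmult k s.
Proof.
move=> kn; rewrite /qmult big_cons -(qbin_qfac kn) invfM.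
have := qfac_neq0 (n - k); move: (qfac (n - k)) => x x0.
by rewrite -!mulrA; congr (_ * (_ * _)); rewrite mulVKf.
Qed.

Lemma signr_eq_odd m n : odd m = odd n -> (-1) ^+ m = (-1) ^+ n :> K.
Proof. by move=> e; rewrite -signr_odd e signr_odd. Qed.

(** The closed form of the coefficient of a chain. The powers of [a] and the
    signs add up along the chain, while the q-binomials telescope to a
    q-multinomial by [qmult_cons]. *)
Lemma weightE n s : sorted geq (n :: s) ->
  weight n s =
  (-1) ^+ (size s * n + (n - last n s) + \sum_(i < size s) nth 0%N s i) *
  (a ^+ (2 * (n - last n s + \sum_(i < size s) (nth 0%N s i ^ 2 + nth 0%N s i)))
     / a ^+ (size s * (n ^ 2 + 2 * n))) *
  qmult n (gaps n s).
Proof.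
elim: s n => [|k s IH] n.
  rewrite /= subnn !big_ord0 mul0n !addn0 muln0 !expr0 divr1 !mul1r.
  by rewrite /qmult /gaps /= big_seq1 divff ?qfac_neq0.
move=> sn; have /andP[kn sk] : (k <= n)%N && sorted geq (k :: s) by [].
have := sorted_geq_last sk.
rewrite gaps_cons qmult_cons // [weight _ _]/= IH //.
rewrite !big_ord_recl /= -/(2%N) /crossing_coef /curl_coef.
set l := last k s => lk.
set S1 := (\sum_(i < _) nth _ _ _)%N; set S2 := (\sum_(i < _) _)%N.
set m := size s; set Q := qmult _ _; set B := qbin n k.
rewrite !exprMn exprVn -!exprM.
transitivity
  ((-1) ^+ ((n - k) * m) * (-1) ^+ (m * k + (k - l) + S1) *
   (a ^+ (2 * k ^ 2) * a ^+ ((k ^ 2 + 2 * k) * m) * a ^+ (2 * (k - l + S2)) /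
    (a ^+ (n ^ 2) * a ^+ ((n ^ 2 + 2 * n) * m) * a ^+ (m * (k ^ 2 + 2 * k)))) *
   (B * Q)).
  by rewrite !invfM; ring.
congr (_ * _ * _).
  rewrite -exprD; apply: signr_eq_odd.
(* The two exponents of -1 differ by the even number 2n. *)
  have -> : (m.+1 * n + (n - l) + (k + S1) =
             (n - k) * m + (m * k + (k - l) + S1) + n.*2)%N.
    by rewrite mulnC mulnSr mulnBl; have := leq_mul kn (leqnn m); lia.
  by rewrite [RHS]oddD odd_double addbF.
apply/eqP; rewrite eqr_div ?mulf_neq0 ?expf_neq0 // -!exprD; apply/eqP.
by congr (_ ^+ _); nia.
Qed.

End Scalars.

Lemma q14_neq0 : q14 != 0.
Proof. by rewrite /q14 tofrac_eq0 polyX_eq0. Qed.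

(** A positive power of the indeterminate has no constant term. *)
Lemma q14X_neq1 n : (0 < n)%N -> q14 ^+ n != 1.
Proof.
move=> n0; rewrite /q14 -tofracXn -tofrac1 tofrac_eq.
apply/eqP => /(congr1 (fun p : {poly rat} => p`_0)).
rewrite coefXn coef1 /= eq_sym (negbTE (lt0n_neq0 n0)) => /eqP.
by rewrite eq_sym oner_eq0.
Qed.

(** * Temperley-Lieb calculus *)

Lemma sum_tuple_cons (V : nmodType) (T : finType) m
    (P : pred (seq T)) (f : seq T -> V) :
  \sum_(t : m.+1.-tuple T | P t) f t =
  \sum_(x : T) \sum_(t : m.-tuple T | P (x :: t)) f (x :: t).
Proof.
pose cons_pair (p : T * m.-tuple T) := [tuple of p.1 :: p.2].
rewrite pair_big_dep /= (reindex cons_pair); first by [].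
exists (fun t : m.+1.-tuple T => (thead t, [tuple of behead t])) => t _ /=.
  by case: t => y t; congr pair; apply: val_inj.
by rewrite /cons_pair -tuple_eta.
Qed.

(** The operators are indexed by positions with no upper bound, as if
    infinitely many strands ran below the diagram. A diagram and the same
    diagram with strands added below it are then the same operator, and no
    count of strands has to be carried along. The operator of the leftmost
    slice is applied last. *)
Section Slices.

Variables (K : fieldType) (a : K).
Hypothesis aX_neq1 : forall n, (0 < n)%N -> a ^+ n != 1.
Hypothesis a_neq0 : a != 0.
Notation qnum := (qnum a).
Variables (M : lmodType K) (C O : nat -> {linear M -> M}).

Hypotheses
  (OC : forall i v, O i (C i v) = - qnum 2 *: v)
  (OCS : forall i v, O i (C i.+1 v) = v)
  (OSC : forall i v, O i.+1 (C i v) = v)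
  (CC : forall i j v, (i <= j)%N -> C i (C j v) = C j.+2 (C i v))
  (OO : forall i j v, (i <= j)%N -> O j (O i v) = O i (O j.+2 v))
  (OC_lt : forall i j v, (i <= j)%N -> O i (C j.+2 v) = C j (O i v))
  (OC_gt : forall i j v, (j <= i)%N -> O i.+2 (C j v) = C j (O i v)).

Definition cross i (v : M) : M := a *: v + a^-1 *: C i (O i v).

Fact cross_is_linear i : linear (cross i).
Proof.
move=> c u v; rewrite /cross.
have -> : C i (O i (c *: u + v)) = c *: C i (O i u) + C i (O i v).
  by rewrite !linearP.
by rewrite !scalerDr !scalerA [a * c]mulrC [_^-1 * c]mulrC addrACA.
Qed.
HB.instance Definition _ i :=
  GRing.isLinear.Build K M M *:%R (cross i) (cross_is_linear i).

(** Reidemeister I: an arc followed by a crossing of its own ends. *)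
Lemma O_cross i v : O i (cross i v) = - a ^- 3 *: O i v.
Proof.
rewrite /cross linearD !linearZ /= OC !scalerA -scalerDl qnum2 //.
by congr (_ *: _); field.
Qed.

Lemma O_crossS i v : O i (cross i.+1 v) = a *: O i v + a^-1 *: O i.+1 v.
Proof. by rewrite /cross linearD !linearZ /= OCS. Qed.

Lemma OS_cross i v : O i.+1 (cross i v) = a *: O i.+1 v + a^-1 *: O i v.
Proof. by rewrite /cross linearD !linearZ /= OSC. Qed.

Lemma O_cross_lt i j v : (i <= j)%N -> O i (cross j.+2 v) = cross j (O i v).
Proof. by move=> ij; rewrite /cross linearD !linearZ /= OC_lt // -OO. Qed.

Lemma O_cross_gt i j v : (j <= i)%N -> O i.+2 (cross j v) = cross j (O i.+2 v).
Proof. by move=> ji; rewrite /cross linearD !linearZ /= OC_gt // OO. Qed.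

Lemma cross_comm i j v :
  (i <= j)%N -> cross i (cross j.+2 v) = cross j.+2 (cross i v).
Proof.
move=> ij; have C_cross w : C i (cross j w) = cross j.+2 (C i w).
  by rewrite /cross linearD !linearZ /= CC // OC_gt.
rewrite {1}/cross O_cross_lt // C_cross.
by rewrite -[cross i v]/(a *: v + a^-1 *: C i (O i v)) [RHS]linearD !linearZ.
Qed.

(** Reidemeister II: the strand coming from below passes under both ends of a
    newly opened arc, which it slides off. *)
Lemma O_cross_up i v : O i (cross i.+1 (cross i v)) = O i.+1 v.
Proof.
rewrite O_crossS O_cross OS_cross scalerDr !scalerA addrCA -scalerDl.
rewrite mulVf ?a_neq0 // scale1r -[RHS]addr0; congr (_ + _).
suff -> : a * - a ^- 3 + a^-1 / a = 0 by rewrite scale0r.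
by field.
Qed.

Lemma O_cross_down i v : O i.+1 (cross i (cross i.+1 v)) = O i v.
Proof.
rewrite OS_cross O_cross O_crossS scalerDr !scalerA addrCA -scalerDl.
rewrite mulVf ?a_neq0 // scale1r -[RHS]addr0; congr (_ + _).
suff -> : a * - a ^- 3 + a^-1 / a = 0 by rewrite scale0r.
by field.
Qed.

(** The three ways of cutting a crossing of cables: in [up d h] the strand at
    position [d + h] rises under [h] strands to position [d]; in [down d h]
    the strand at position [d] descends over [h] strands to position [d + h];
    in [twine d s t] the [s] strands starting at position [d] cross over the
    next [t], row after row. *)
Fixpoint up d h v := if h is h'.+1 then cross (d + h') (up d h' v) else v.
Fixpoint down d h v := if h is h'.+1 then cross d (down d.+1 h' v) else v.
Fixpoint twine d s t v := if t is t'.+1 then up d s (twine d.+1 s t' v) else v.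

Lemma twine_rows d s t v : twine d s t.+1 v = up d s (twine d.+1 s t v).
Proof. by []. Qed.

Lemma upSr d h v : up d h.+1 v = cross (d + h) (up d h v).
Proof. by []. Qed.

Lemma twine_nil d t v : twine d 0 t v = v.
Proof. by elim: t d => //= t IH d. Qed.

Lemma up0 d h : up d h 0 = 0.
Proof. by elim: h => //= h ->; rewrite linear0. Qed.

Lemma down0 d h : down d h 0 = 0.
Proof. by elim: h d => //= h IH d; rewrite IH linear0. Qed.

Lemma twine0 d s t : twine d s t 0 = 0.
Proof. by elim: t d => //= t IH d; rewrite IH up0. Qed.

Lemma up_add d h k v : up d (h + k) v = up (d + h) k (up d h v).
Proof. by elim: k => [|k IH]; rewrite ?addn0 // addnS /= IH addnA. Qed.

Lemma down_add d h k v : down d (h + k) v = down d h (down (d + h) k v).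
Proof.
by elim: h d => [|h IH] d; rewrite ?addn0 //= IH addSnnS.
Qed.

Lemma up_cross d h j v :
  (d + h <= j)%N -> up d h (cross j.+1 v) = cross j.+1 (up d h v).
Proof.
elim: h => //= h IH hj; rewrite IH; last by lia.
by case: j {IH} hj => [|j] hj; [lia | rewrite cross_comm //; lia].
Qed.

Lemma cross_up d h j v :
  (j < d)%N -> cross j (up d.+1 h v) = up d.+1 h (cross j v).
Proof.
move=> jd; elim: h => //= h IH; rewrite addSn -IH.
by case: d jd {IH} => // d jd; rewrite addSn cross_comm //; lia.
Qed.

Lemma up_down d h e k v :
  (d + h < e)%N -> up d h (down e k v) = down e k (up d h v).
Proof.
elim: k e => //= k IH e he; case: e he => // e he.
by rewrite up_cross ?IH //; lia.
Qed.

Lemma twine_cross d s t j v :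
  (j < d)%N -> cross j (twine d.+1 s t v) = twine d.+1 s t (cross j v).
Proof.
by elim: t d => //= t IH d jd; rewrite cross_up // IH //; lia.
Qed.

(** The strands of the upper cable can be drawn one after the other instead of
    those of the lower cable. Here the lowest strand of the upper cable is
    drawn first; in [twineS_first] its highest strand is drawn last. *)
Lemma twineS_down d s t v :
  twine d s.+1 t v = down (d + s) t (twine d s t v).
Proof.
elim: t d => //= t IH d; rewrite IH -up_down; last by lia.
by rewrite addSn.
Qed.

Lemma upS d h v : up d h.+1 v = up d.+1 h (cross d v).
Proof. by rewrite -add1n up_add /= addn0 addn1. Qed.

Lemma twineS_first d s t v :
  twine d s.+1 t v = twine d.+1 s t (down d t v).
Proof.
by elim: t d => // t IH d; rewrite twine_rows IH upS twine_cross.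
Qed.

Lemma O_up_lt i d h v : (i <= d)%N -> O i (up d.+2 h v) = up d h (O i v).
Proof.
by move=> id; elim: h => //= h IH; rewrite !addSn O_cross_lt ?IH //; lia.
Qed.

Lemma O_up_gt i d h v : (d + h < i)%N -> O i (up d h v) = up d h (O i v).
Proof.
elim: h => //= h IH; case: i IH => [|[|i]] IH hi; [lia | lia |].
by rewrite O_cross_gt ?IH //; lia.
Qed.

Lemma O_down_lt i d h v : (i <= d)%N -> O i (down d.+2 h v) = down d h (O i v).
Proof.
by elim: h d => //= h IH d id; rewrite O_cross_lt ?IH //; lia.
Qed.

Lemma O_down_gt i d h v : (d + h < i)%N -> O i (down d h v) = down d h (O i v).
Proof.
elim: h d => //= h IH d hi; case: i IH hi => [|[|i]] IH hi; [lia | lia |].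
by rewrite O_cross_gt ?IH //; lia.
Qed.

Lemma O_twine_lt i d s t v :
  (i <= d)%N -> O i (twine d.+2 s t v) = twine d s t (O i v).
Proof. by elim: t d => //= t IH d id; rewrite O_up_lt // IH //; lia. Qed.

Lemma O_up d i h v :
  (i <= h)%N -> O (d + i) (up d h.+2 v) = up d h (O (d + i).+1 v).
Proof.
move=> ih; have -> : h.+2 = (i + 2 + (h - i))%N by lia.
rewrite !up_add /= addn0 addn2 !addnS addn0 O_up_lt // O_cross_up.
rewrite O_up_gt; last by lia.
by rewrite -up_add subnKC.
Qed.

Lemma O_down d i h v :
  (i <= h)%N -> O (d + i).+1 (down d h.+2 v) = down d h (O (d + i) v).
Proof.
move=> ih; have -> : h.+2 = (i + 2 + (h - i))%N by lia.
rewrite !down_add /= !addnS addn0.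
rewrite O_down_gt; last by lia.
by rewrite O_cross_down O_down_lt // -down_add subnKC.
Qed.

(** An arc opened inside one of the two cables slides through the whole
    crossing and reappears as an arc inside the other group of right ends. *)
Lemma O_twine_upper d i s t v :
  (i <= s)%N -> O (d + i) (twine d s.+2 t v) = twine d s t (O (d + i + t) v).
Proof.
move=> hi; elim: t d => [|t IH] d; first by rewrite addn0.
by rewrite twine_rows O_up // -addSn IH addSn addnS.
Qed.

Lemma O_twine_lower d i s t v :
  (i <= t)%N -> O (d + s + i) (twine d s t.+2 v) = twine d s t (O (d + i) v).
Proof.
move=> hi; elim: s => [|s IH].
  by rewrite addn0 !twine_nil.
rewrite !twineS_down addnS addSn O_down //; congr down; exact: IH.
Qed.

(** If [v] kills arcs among the crossed strands, an arc whose end crosses [h]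
    strands must be smoothed vertically at each crossing: a horizontal
    smoothing leaves an arc that commutes with the rest and reaches [v]. *)
Lemma O_up_free d h v :
  (forall i, (d < i <= d + h)%N -> O i v = 0) ->
  O (d + h) (up d h v) = a ^- h *: O d v.
Proof.
elim: h => [|h IH] hv; first by rewrite addn0 /= expr0 invr1 scale1r.
rewrite addnS /= OS_cross O_up_gt; last by lia.
rewrite hv ?up0 ?scaler0 ?add0r; last by lia.
rewrite IH ?scalerA -?invfM -?exprS // => i hi; apply: hv; lia.
Qed.

Lemma O_down_free d h v :
  (forall i, (d <= i < d + h)%N -> O i v = 0) ->
  O d (down d.+1 h v) = a ^- h *: O (d + h) v.
Proof.
elim: h d => [|h IH] d hv; first by rewrite addn0 /= expr0 invr1 scale1r.
rewrite /= O_crossS O_down_lt // hv ?down0 ?scaler0 ?add0r; last by lia.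
rewrite IH; last by move=> i hi; apply: hv; lia.
by rewrite scalerA -invfM -exprS addSnnS.
Qed.

(** What a pair of clasps on the left of [v] guarantees: a turnback is killed
    unless it joins the two groups of [n] strands, at positions [d + n - 1]
    and [d + n]. *)
Definition turnback_free d n v :=
  forall i, (i.+1 < n + n)%N -> i.+1 <> n -> O (d + i) v = 0.

Lemma turnback_free_twine n v :
  turnback_free 0 n v -> turnback_free 0 n (twine 0 n n v).
Proof.
move=> fv i i1 i2; case: (ltnP i n) => hi.
  case: n fv i1 i2 hi => [|[|n]] fv i1 i2 hi; [lia | lia |].
  rewrite O_twine_upper; last by lia.
  rewrite -addnA fv ?twine0 //; lia.
case: n fv i1 i2 hi => [|[|n]] fv i1 i2 hi; [lia | lia |].
rewrite -(subnKC hi) addnA O_twine_lower; last by lia.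
rewrite fv ?twine0 //; lia.
Qed.

Lemma turnback_free_O d n v :
  turnback_free d n.+1 v -> turnback_free d n (O (d + n) v).
Proof.
move=> fv i i1 i2; case: (leqP n i) => hi.
  by rewrite OO ?leq_add2l // -!addnS fv ?linear0 //; lia.
have -> : (d + n = (d + n.-2).+2)%N by lia.
rewrite -OO ?fv ?linear0 //; lia.
Qed.

Lemma upZ d h c v : up d h (c *: v) = c *: up d h v.
Proof. by elim: h => //= h ->; rewrite linearZ. Qed.

Lemma twineZ d s t c v : twine d s t (c *: v) = c *: twine d s t v.
Proof. by elim: t d => //= t IH d; rewrite IH upZ. Qed.

Section OneTwine.
Variables (d p : nat) (v : M).
Hypothesis fv : turnback_free d p.+1 v.

(** The arc opened across the two groups, with its upper end moved to the top
    of the crossing. *)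
Lemma O_up_twine :
  O (d + p) (up d p (twine d.+1 p.+1 p v)) =
  a ^- p *: O d (twine d.+1 p.+1 p v).
Proof.
apply: O_up_free => i hi; case: p fv hi => [|p'] fv' hi; first by lia.
have -> : (i = d.+1 + (i - d.+1))%N by lia.
rewrite O_twine_upper; last by lia.
have -> : (d.+1 + (i - d.+1) + p'.+1 = d + (i - d.+1 + p'.+2))%N by lia.
by rewrite fv' ?twine0 //; lia.
Qed.

(** The same arc, whose lower end is then carried by the highest strand of the
    upper cable through the rest of the crossing. *)
Lemma O_twine_top :
  O d (twine d.+1 p.+1 p v) = a ^- p *: twine d p p (O (d + p) v).
Proof.
rewrite twineS_first O_twine_lt // O_down_free ?twineZ // => i hi.
by have := @fv (i - d)%N; rewrite subnKC; [apply; lia | lia].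
Qed.

(** The first crossing is between the two ends of the arc, a curl; the ends
    are then freed from the other strands by [O_up_twine] and
    [O_twine_top]. *)
Lemma O_twine : O (d + p) (twine d p.+1 p.+1 v) =
  - a ^- (2 * p + 3) *: twine d p p (O (d + p) v).
Proof.
rewrite twine_rows upSr O_cross O_up_twine O_twine_top !scalerA !mulNr.
by rewrite -!invfM -!exprD; congr (- _ ^- _ *: _); lia.
Qed.

(** The first row is the highest strand of the lower cable rising under the
    upper one. If its first crossing is smoothed horizontally, [x] kills the
    vertical smoothings of the rest of the row, and then those along the
    lowest strand of the remaining upper cable, drawn next by [twineS_down].
    If it is smoothed vertically, the arc that opens is followed by
    [O_up_twine] and [O_twine_top]. *)
Lemma twine_expand (L : lmodType K) (x : {linear M -> L}) :
  (forall i w, (i < 2 * p + 1)%N -> i <> p -> x (C (d + i) w) = 0) ->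
  x (twine d p.+1 p.+1 v) =
  a ^+ (2 * p + 1) *: x (twine d.+1 p p v) +
  a ^- (2 * p + 1) *: x (C (d + p) (twine d p p (O (d + p) v))).
Proof.
move=> fx.
have x_cross i w : (i < 2 * p + 1)%N -> i <> p ->
    x (cross (d + i) w) = a *: x w.
  by move=> h1 h2; rewrite /cross linearD !linearZ /= fx // scaler0 addr0.
have x_up h w : (h <= p)%N -> x (up d h w) = a ^+ h *: x w.
  elim: h => [|h IH] hp; first by rewrite scale1r.
  rewrite /= x_cross ?IH ?scalerA -?exprS //; lia.
have x_down h w : (h <= p)%N ->
    x (down (d + (2 * p + 1 - h)) h w) = a ^+ h *: x w.
  elim: h => [|h IH] hp; first by rewrite scale1r.
  rewrite /= x_cross; [|lia|lia].
  have -> : ((d + (2 * p + 1 - h.+1)).+1 = d + (2 * p + 1 - h))%N by lia.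
  by rewrite IH ?scalerA -?exprS //; lia.
rewrite twine_rows upSr {1}/cross linearD !linearZ /=.
rewrite x_up // O_up_twine O_twine_top !linearZ /= twineS_down.
have -> : (d.+1 + p = d + (2 * p + 1 - p))%N by lia.
rewrite x_down // !scalerA; congr (_ *: _ + _ *: _).
  by rewrite mulrAC -exprD -exprSr; congr (_ ^+ _); lia.
by rewrite -!invfM -exprD -exprSr; congr (_ ^- _); lia.
Qed.

End OneTwine.

Fixpoint closes d j v := if j is j'.+1 then C (d + j') (closes d j' v) else v.
Fixpoint opens d j v := if j is j'.+1 then opens d j' (O (d + j') v) else v.
Definition turn d j v := closes d j (opens d j v).

Fact closes_is_linear d j : linear (closes d j).
Proof. by elim: j => //= j IH c u v; rewrite IH linearP. Qed.
HB.instance Definition _ d j :=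
  GRing.isLinear.Build K M M *:%R (closes d j) (closes_is_linear d j).

Lemma opensZ d j c v : opens d j (c *: v) = c *: opens d j v.
Proof. by elim: j v => //= j IH v; rewrite linearZ IH. Qed.

Lemma turnS d j v : turn d j.+1 v = C (d + j) (turn d j (O (d + j) v)).
Proof. by []. Qed.

Lemma closes_add d i j v : closes d (i + j) v = closes (d + i) j (closes d i v).
Proof. by elim: j => [|j IH]; rewrite ?addn0 // addnS /= IH addnA. Qed.

Lemma opens_add d i j v : opens d (i + j) v = opens d i (opens (d + i) j v).
Proof.
by elim: j v => [|j IH] v; rewrite ?addn0 // addnS /= IH addnA.
Qed.

Lemma turn_add d i j v :
  turn d (i + j) v = closes (d + i) j (turn d i (opens (d + i) j v)).
Proof. by rewrite /turn closes_add opens_add. Qed.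

(** The same property as [turnback_free] for the diagram drawn on the left. *)
Definition turnback_cofree (L : lmodType K) d n (x : M -> L) :=
  forall i w, (i.+1 < n + n)%N -> i.+1 <> n -> x (C (d + i) w) = 0.

Lemma turnback_cofree_C (L : lmodType K) d n (x : {linear M -> L}) :
  turnback_cofree d n.+1 x -> turnback_cofree d n (x \o C (d + n)).
Proof.
move=> fx i w i1 i2 /=; case: (leqP n i) => hi.
  by rewrite CC ?leq_add2l // -!addnS fx //; lia.
have -> : (d + n = (d + n.-2).+2)%N by lia.
rewrite -CC ?fx //; lia.
Qed.

Lemma turnback_cofree_closes (L : lmodType K) n j (x : {linear M -> L}) :
  turnback_cofree 0 (n + j) x -> turnback_cofree 0 n (x \o closes n j).
Proof.
elim: j n x => [|j IH] n x; first by rewrite addn0.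
by rewrite addnS => /turnback_cofree_C /IH.
Qed.

(** The two terms of [twine_expand] are crossings of cables with one strand
    less, in the first case shifted down by the straight strand added on top,
    in the second enclosed between the two arcs of a turnback; the hypotheses
    on [x] and [v] pass to both. *)
Theorem twine_sum (L : lmodType K) n d (x : {linear M -> L}) v :
  turnback_cofree d n x -> turnback_free d n v ->
  x (twine d n n v) =
  \sum_(k < n.+1) crossing_coef a n k *: x (turn (d + k) (n - k) v).
Proof.
elim: n d x v => [|p IH] d x v fx fv.
  by rewrite big_ord1 crossing_coef00 scale1r.
rewrite twine_expand //; last by move=> i w h1 h2; apply: fx; lia.
rewrite IH; first last.
- by move=> i i1 i2; rewrite addSnnS fv //; lia.
- by move=> i w i1 i2; rewrite addSnnS fx //; lia.
have /= -> := IH d (x \o C (d + p)) (O (d + p) v)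
  (turnback_cofree_C fx) (turnback_free_O fv).
pose f k := x (turn (d + k) (p.+1 - k) v).
have e1 :
    \sum_(k < p.+1) crossing_coef a p k *: x (turn (d.+1 + k) (p - k) v) =
    \sum_(k < p.+1) crossing_coef a p k *: f k.+1.
  by apply: eq_bigr => k _; rewrite /f subSS addSnnS.
have e2 : \sum_(k < p.+1) crossing_coef a p k *:
            x (C (d + p) (turn (d + k) (p - k) (O (d + p) v))) =
          \sum_(k < p.+1) crossing_coef a p k *: f k.
  apply: eq_bigr => k _; have kp : (k <= p)%N by rewrite -ltnS.
  by rewrite /f subSn // turnS -addnA subnKC.
rewrite e1 e2 [in RHS]big_ord_recl /= -/(f 0%N) crossing_coef0 //.
rewrite [X in _ + _ *: X]big_ord_recl /= scalerDr scalerA addrCA; congr (_ + _).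
have -> : \sum_(k < p.+1) crossing_coef a p.+1 (bump 0 k) *:
              x (turn (d + bump 0 k) (p.+1 - bump 0 k) v) =
    a ^- (2 * p + 1) *: \sum_(k < p.+1) crossing_coef a p k.+1 *: f k.+1 +
    a ^+ (2 * p + 1) *: \sum_(k < p.+1) crossing_coef a p k *: f k.+1.
  rewrite !scaler_sumr -big_split; apply: eq_bigr => k _ /=.
  by rewrite !scalerA -scalerDl -crossing_coef_pascal //.
rewrite addrC; congr (_ *: _ + _).
by rewrite big_ord_recr /= crossing_coef_small // scale0r addr0.
Qed.

Lemma opens_twine k j v : turnback_free 0 (k + j) v ->
  opens k j (twine 0 (k + j) (k + j) v) =
  curl_coef a (k + j) k *: twine 0 k k (opens k j v).
Proof.
elim: j v => [|j IH] v fv; first by rewrite addn0 curl_coef_nn // scale1r.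
rewrite addnS in fv *; have := O_twine fv; rewrite add0n /= => ->.
rewrite opensZ IH; last by have := turnback_free_O fv.
by rewrite scalerA curl_coefS ?leq_addr // addnS.
Qed.

Lemma turnback_free_opens k j v : turnback_free 0 (k + j) v ->
  turnback_free 0 k (opens k j v).
Proof.
elim: j v => [|j IH] v; first by rewrite addn0.
by rewrite addnS => /turnback_free_O /IH.
Qed.

Lemma turnback_free_iter_twine n m v :
  turnback_free 0 n v -> turnback_free 0 n (iter m (twine 0 n n) v).
Proof. by move=> fv; elim: m => //= m IH; apply: turnback_free_twine. Qed.

Lemma opens_iter_twine k j m v : turnback_free 0 (k + j) v ->
  opens k j (iter m (twine 0 (k + j) (k + j)) v) =
  curl_coef a (k + j) k ^+ m *: iter m (twine 0 k k) (opens k j v).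
Proof.
move=> fv; elim: m => [|m IH]; first by rewrite scale1r.
rewrite [in LHS]iterS opens_twine; last exact: turnback_free_iter_twine.
by rewrite IH twineZ scalerA -exprS.
Qed.

(** The bound [B] on the indices is independent of [n], so that the induction
    hypothesis, used with [n] replaced by the first index [k], sums over
    tuples of the same type. *)
Theorem twists_sum B m n (L : lmodType K) (x : {linear M -> L}) v :
  (n <= B)%N -> turnback_cofree 0 n x -> turnback_free 0 n v ->
  x (iter m (twine 0 n n) v) =
  \sum_(k : m.-tuple 'I_B.+1 | sorted geq (n :: map val k))
    weight a n (map val k) *:
      x (turn (last n (map val k)) (n - last n (map val k)) v).
Proof.
elim: m n L x v => [|m IH] n L x v nB fx fv.
  rewrite (big_pred1 [tuple]) => [|t]; last by rewrite tuple0; apply/esym/eqP.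
  by rewrite /= subnn scale1r.
rewrite iterS twine_sum //; last exact: turnback_free_iter_twine.
rewrite (big_ord_widen B.+1
  (fun k => crossing_coef a n k *:
     x (turn (0 + k) (n - k) (iter m (twine 0 n n) v)))) //.
rewrite (sum_tuple_cons m
  (fun s : seq 'I_B.+1 => sorted geq (n :: map val s))
  (fun s => weight a n (map val s) *:
     x (turn (last n (map val s)) (n - last n (map val s)) v))).
rewrite big_mkcond; apply: eq_bigr => k _.
case: ifP => kn; last first.
  by rewrite big1 // => t /= /andP[/= kn' _]; rewrite /geq in kn'; lia.
have e : (k + (n - k) = n)%N by lia.
rewrite -e in fv fx; have := opens_iter_twine m fv; rewrite e => e'.
rewrite add0n [turn k _ _]/turn e' !linearZ /= scalerA.
have /= -> := IH k _ (x \o closes k (n - k)) (opens k (n - k) v) _ _ _;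
  first last.
- exact: turnback_free_opens.
- exact: turnback_cofree_closes.
- by lia.
rewrite scaler_sumr; apply: eq_big => [t|t ht] /=; first by rewrite -ltnS kn.
rewrite scalerA size_map size_tuple [curl_coef _ _ _ ^+ _ * _]mulrC.
congr (_ *: x _).
set l := last _ _; have lk : (l <= k)%N by apply: sorted_geq_last.
have -> : (n - l = (k - l) + (n - k))%N by lia.
by rewrite turn_add subnKC.
Qed.

(** The clasp on the [n] strands that start at position [d]. *)
Fixpoint jw d n : M -> M :=
  if n isn't n1.+1 then id else
  if n1 isn't n2.+1 then id else fun v =>
  jw d n1 v +
    (qnum n1 / qnum n) *: jw d n1 (C (d + n2) (O (d + n2) (jw d n1 v))).

Lemma jwSS d n v : jw d n.+2 v = jw d n.+1 v +
  (qnum n.+1 / qnum n.+2) *: jw d n.+1 (C (d + n) (O (d + n) (jw d n.+1 v))).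
Proof. by []. Qed.

Arguments jw : simpl never.

Fact jw_is_linear d n : linear (jw d n).
Proof.
elim: n => [|[|n] IH] c u v //; rewrite !jwSS !(linearP, IH) scalerDr.
by rewrite addrACA.
Qed.
HB.instance Definition _ d n :=
  GRing.isLinear.Build K M M *:%R (jw d n) (jw_is_linear d n).

Lemma jw_O d n j v : (d + n <= j)%N -> O j (jw d n v) = jw d n (O j v).
Proof.
elim: n v => [|[|n] IH] v // hj; rewrite !jwSS linearD linearZ /= !IH; try lia.
case: j IH hj => [|[|j]] IH hj; [lia | lia |].
rewrite OC_gt; last by lia.
rewrite OO; last by lia.
by rewrite IH //; lia.
Qed.

Lemma jw_C d n j v : (d + n <= j)%N -> jw d n (C j v) = C j (jw d n v).
Proof.
elim: n v => [|[|n] IH] v // hj; rewrite !jwSS linearD linearZ /= !IH; try lia.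
case: j IH hj => [|[|j]] IH hj; [lia | lia |].
rewrite OC_lt; last by lia.
rewrite CC; last by lia.
by rewrite IH //; lia.
Qed.

Lemma jw_C_shift d n i v : (i <= d)%N -> jw d.+2 n (C i v) = C i (jw d n v).
Proof.
move=> id; elim: n v => [|[|n] IH] v //; rewrite !jwSS linearD linearZ /= !IH.
rewrite !addSn OC_gt; last by lia.
rewrite -CC ?IH //; lia.
Qed.

Section JonesWenzl.
Variable d : nat.

(** Only the last strand is traced: by [jw_O] and [jw_C] the smaller clasps in
    the recursion commute with the closing arc, which leaves a circle in one
    term and a straightened strand in the other. *)
Lemma jw_partial_trace n v : (forall w, jw d n (jw d n w) = jw d n w) ->
  O (d + n) (jw d n.+1 (C (d + n) v)) = - (qnum n.+2 / qnum n.+1) *: jw d n v.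
Proof.
case: n v => [|n] v idem; first by rewrite OC qnum1 // divr1.
rewrite jwSS linearD linearZ /= !(jw_O _ (leqnn (d + n.+1))) OC.
rewrite (jw_C _ (leqnn (d + n.+1))) addnS OCS OSC.
rewrite idem linearZ -scalerDl; congr (_ *: _).
have h : qnum n.+2 != 0 by apply: qnum_neq0.
by rewrite (qnum_rec _ _ n.+1) // mulrBl mulfK // opprB addrC.
Qed.

Definition jw_projector n :=
  [/\ forall v, jw d n (jw d n v) = jw d n v,
      forall i v, (i.+1 < n)%N -> O (d + i) (jw d n v) = 0 &
      forall i v, (i.+1 < n)%N -> jw d n (C (d + i) v) = 0].

(** Two consecutive cases are carried together, since the recursion kills the
    turnback at the last position by the partial trace of the clasp of size
    [n.+1], which involves the clasp of size [n]. *)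
Lemma jw_projectorP n : jw_projector n /\ jw_projector n.+1.
Proof.
elim: n => [|n [[id0 _ _] P1]]; first by [].
split=> //; case: P1 => id1 O1 C1.
have left1 v : jw d n (jw d n.+1 v) = jw d n.+1 v.
  case: n id0 {id1 O1 C1} => // n id0.
  by rewrite !jwSS linearD linearZ /= !id0.
have right1 v : jw d n.+1 (jw d n v) = jw d n.+1 v.
  case: n id0 {id1 O1 C1 left1} => // n id0.
  by rewrite !jwSS !id0.
have coef : qnum n.+1 / qnum n.+2 * - (qnum n.+2 / qnum n.+1) = -1.
  have h1 : qnum n.+1 != 0 by apply: qnum_neq0.
  have h2 : qnum n.+2 != 0 by apply: qnum_neq0.
  by field; rewrite h1 h2.
have O2 i v : (i.+1 < n.+2)%N -> O (d + i) (jw d n.+2 v) = 0.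
  rewrite ltnS leq_eqVlt => /predU1P[[->]|hi].
    rewrite jwSS linearD linearZ /= jw_partial_trace // scalerA coef scaleN1r.
    by rewrite -jw_O // left1 subrr.
  by rewrite jwSS linearD linearZ /= !O1 // scaler0 addr0.
have C2 i v : (i.+1 < n.+2)%N -> jw d n.+2 (C (d + i) v) = 0.
  rewrite ltnS leq_eqVlt => /predU1P[[->]|hi].
    rewrite jwSS jw_partial_trace // !linearZ /= scalerA.
    rewrite [X in X *: _]mulrC coef scaleN1r.
    by rewrite -jw_C // right1 subrr.
  by rewrite jwSS !(C1 i) // !linear0 addr0.
split=> // v; rewrite jwSS.
have e : jw d n.+1 (jw d n.+2 v) = jw d n.+2 v.
  by rewrite jwSS linearD linearZ /= !id1.
by rewrite e O2 // !linear0 addr0.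
Qed.

End JonesWenzl.

Definition two_jw n v := jw 0 n (jw n n v).

Fact two_jw_is_linear n : linear (two_jw n).
Proof. by move=> c u v; rewrite /two_jw !linearP. Qed.
HB.instance Definition _ n :=
  GRing.isLinear.Build K M M *:%R (two_jw n) (two_jw_is_linear n).

Lemma two_jw_free n v : turnback_free 0 n (two_jw n v).
Proof.
have [[_ O1 _] _] := jw_projectorP 0 n.
have [[_ O2 _] _] := jw_projectorP n n.
move=> i i1 i2; rewrite /two_jw; case: (ltnP i n) => hi.
  by rewrite O1 //; lia.
rewrite add0n jw_O // -(subnKC hi) O2 ?linear0 //; lia.
Qed.

Lemma two_jw_cofree n : turnback_cofree 0 n (two_jw n).
Proof.
have [[_ _ C1] _] := jw_projectorP 0 n.
have [[_ _ C2] _] := jw_projectorP n n.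
move=> i v i1 i2; rewrite /two_jw add0n; case: (ltnP i n) => hi; last first.
  rewrite -(subnKC hi) C2 ?linear0 //; lia.
case: n {C2} C1 i1 i2 hi => [|[|n]] C1 i1 i2 hi; [lia | lia |].
rewrite jw_C_shift; last by lia.
by have := C1 i (jw n n.+2 v); rewrite add0n; apply; lia.
Qed.

Theorem clasped_twists_sum m n v :
  two_jw n (iter m (twine 0 n n) (two_jw n v)) =
  \sum_(k : m.-tuple 'I_n.+1 | sorted geq (n :: map val k))
    weight a n (map val k) *:
      two_jw n (turn (last n (map val k)) (n - last n (map val k))
        (two_jw n v)).
Proof.
exact: twists_sum (leqnn n) (@two_jw_cofree n) (two_jw_free v).
Qed.

End Slices.

(** * Pairings of infinitely many ends *)

Section Pairings.
Local Open Scope nat_scope.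

(** The relations between slices hold for all fixed-point-free involutions of
    the labels, of which crossingless systems are the planar ones. *)
Definition pairing (p : nat -> nat) := forall x, p x <> x /\ p (p x) = x.

Variant skip_spec i : nat -> Type :=
  | SkipFst : skip_spec i i
  | SkipSnd : skip_spec i i.+1
  | SkipOut z : skip_spec i (skip2 i z).

Lemma skipP i x : skip_spec i x.
Proof.
case: (eqVneq x i) => [->|xi]; first exact: SkipFst.
case: (eqVneq x i.+1) => [->|xi1]; first exact: SkipSnd.
by rewrite -(@unskip2K i x); [exact: SkipOut | exact/eqP | exact/eqP].
Qed.

Lemma skip2_skip2 i j x :
  i <= j -> skip2 i (skip2 j x) = skip2 j.+2 (skip2 i x).
Proof.
by move=> ij; rewrite /skip2; do ?case: ifP; lia.
Qed.

Lemma skip2_le i j : i <= j -> skip2 i j = j.+2.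
Proof. by rewrite /skip2; case: ifP; lia. Qed.

Lemma skip2_gt i j : j < i -> skip2 i j = j.
Proof. by rewrite /skip2; case: ifP; lia. Qed.

Lemma open_arc_fst i p : open_arc i p i = i.+1.
Proof. by rewrite /open_arc eqxx. Qed.

Lemma open_arc_snd i p : open_arc i p i.+1 = i.
Proof. by rewrite /open_arc eqxx gtn_eqF. Qed.

Lemma open_arc_skip i p z : open_arc i p (skip2 i z) = skip2 i (p z).
Proof.
by rewrite /open_arc skip2K; have /andP[/negPf -> /negPf ->] := skip2_neq i z.
Qed.

Lemma skip2_fst i z : (skip2 i z == i) = false.
Proof. by have /andP[/negPf] := skip2_neq i z. Qed.

Lemma skip2_snd i z : (skip2 i z == i.+1) = false.
Proof. by have /andP[_ /negPf] := skip2_neq i z. Qed.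

Lemma skip2_inj i : injective (skip2 i).
Proof. exact: can_inj (skip2K i). Qed.

Lemma open_pairing i p : pairing p -> pairing (open_arc i p).
Proof.
move=> hp x; case: (skipP i x) => [||z].
- by rewrite open_arc_fst open_arc_snd; split=> //; lia.
- by rewrite open_arc_snd open_arc_fst; split=> //; lia.
rewrite !open_arc_skip; have [h ->] := hp z.
by split=> // /(can_inj (@skip2K i)).
Qed.

(** Closing [i], [i.+1] before the positions are renumbered: the partner of
    [y] when the ends [i] and [i.+1] have been joined. *)
Definition cut (i : nat) p (y : nat) : nat :=
  if p y == i then p i.+1 else if p y == i.+1 then p i else p y.

Lemma cutP i p y : pairing p -> y <> i -> y <> i.+1 ->
  [/\ cut i p y <> i, cut i p y <> i.+1, cut i p y <> y &
      cut i p (cut i p y) = y].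
Proof.
move=> hp yi yj.
have [i1 i2] := hp i; have [j1 j2] := hp i.+1; have [y1 y2] := hp y.
rewrite /cut; case: (eqVneq (p y) i) => [e|/eqP e].
  have e' : p i = y by rewrite -e.
  have n1 : p i.+1 <> i by move=> h; rewrite h in j2; lia.
  have n2 : p i.+1 <> y by move=> h; rewrite h e in j2; lia.
  by rewrite j2 eqxx gtn_eqF.
case: (eqVneq (p y) i.+1) => [e2|/eqP e2].
  have e' : p i.+1 = y by rewrite -e2.
  have n1 : p i <> i.+1 by move=> h; rewrite h in i2; lia.
  have n2 : p i <> y by move=> h; rewrite h e2 in i2; lia.
  by rewrite i2 eqxx.
by rewrite y2; do 2 (case: eqP => // _).
Qed.

Lemma skip2_neqP i z : skip2 i z <> i /\ skip2 i z <> i.+1.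
Proof. by split; apply/eqP; rewrite ?skip2_fst ?skip2_snd. Qed.

(** This trades the renumbering of [close_arc] for the injective map [skip2],
    which is how the relations between slices are checked. *)
Lemma skip2_close i p x :
  pairing p -> skip2 i (close_arc i p x) = cut i p (skip2 i x).
Proof.
move=> hp; have [h1 h2] := skip2_neqP i x.
have [c1 c2 _ _] := cutP hp h1 h2.
by rewrite -[RHS](unskip2K c1 c2).
Qed.

Lemma close_pairing i p : pairing p -> pairing (close_arc i p).
Proof.
move=> hp x; have [h1 h2] := skip2_neqP i x.
have [_ _ c3 c4] := cutP hp h1 h2.
split=> [e|]; first by apply: c3; rewrite -skip2_close // e.
by apply: (@skip2_inj i); rewrite !skip2_close.
Qed.

Lemma close_open i p x : close_arc i (open_arc i p) x = p x.
Proof.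
by rewrite /close_arc open_arc_skip skip2_fst skip2_snd skip2K.
Qed.

(** A strand that zigzags is straight. *)
Lemma closeS_open i p x : close_arc i.+1 (open_arc i p) x = p x.
Proof.
rewrite /close_arc open_arc_snd -[i.+2](skip2_le (leqnn i)).
case: (eqVneq x i) => [->|xi].
  have -> : skip2 i.+1 i = i by rewrite skip2_gt.
  rewrite open_arc_fst eqxx open_arc_skip /unskip2 /skip2.
  by do ?case: ifP; lia.
have -> : skip2 i.+1 x = skip2 i x by rewrite /skip2; do ?case: ifP; lia.
rewrite open_arc_skip skip2_snd (inj_eq (@skip2_inj i)).
by rewrite /unskip2 /skip2; do ?case: ifP; lia.
Qed.

Lemma close_openS i p x :
  pairing p -> close_arc i (open_arc i.+1 p) x = p x.
Proof.
move=> /(_ i)[pi _]; rewrite /close_arc open_arc_fst.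
have ei : skip2 i.+1 i = i by rewrite skip2_gt.
have -> : open_arc i.+1 p i = skip2 i.+1 (p i) by rewrite -{2}ei open_arc_skip.
case: (eqVneq x i) => [->|xi].
  rewrite skip2_le // open_arc_snd gtn_eqF // eqxx.
  by rewrite /unskip2 /skip2; do ?case: ifP; lia.
have -> : skip2 i x = skip2 i.+1 x by rewrite /skip2; do ?case: ifP; lia.
rewrite open_arc_skip skip2_fst.
have -> : (skip2 i.+1 (p x) == i) = (p x == i).
  by rewrite -[X in _ == X]ei (inj_eq (@skip2_inj i.+1)).
by rewrite /unskip2 /skip2; do ?case: ifP; lia.
Qed.

Lemma open_open i j p x : i <= j ->
  open_arc i (open_arc j p) x = open_arc j.+2 (open_arc i p) x.
Proof.
move=> ij; have e1 : skip2 j.+2 i = i by rewrite skip2_gt //; lia.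
have e2 : skip2 j.+2 i.+1 = i.+1 by rewrite skip2_gt //; lia.
have o1 r : open_arc j.+2 r i = skip2 j.+2 (r i).
  by rewrite -[in LHS]e1 open_arc_skip.
have o2 r : open_arc j.+2 r i.+1 = skip2 j.+2 (r i.+1).
  by rewrite -[in LHS]e2 open_arc_skip.
case: (skipP i x) => [||z].
- by rewrite o1 !open_arc_fst e2.
- by rewrite o2 !open_arc_snd e1.
rewrite open_arc_skip; case: (skipP j z) => [||w].
- by rewrite open_arc_fst !skip2_le ?open_arc_fst //; lia.
- by rewrite open_arc_snd !skip2_le ?open_arc_snd //; lia.
by rewrite skip2_skip2 // !open_arc_skip skip2_skip2.
Qed.

Lemma cut_open_lt i j p z : i <= j ->
  cut j.+2 (open_arc i p) (skip2 i z) = skip2 i (cut j p z).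
Proof.
move=> ij; have e1 : j.+2 = skip2 i j by rewrite skip2_le.
have e2 : j.+3 = skip2 i j.+1 by rewrite skip2_le //; lia.
rewrite /cut e2 e1 !open_arc_skip !(inj_eq (@skip2_inj i)).
by do 2?case: ifP.
Qed.

Lemma cut_open_gt i j p z : j <= i ->
  cut j (open_arc i.+2 p) (skip2 i.+2 z) = skip2 i.+2 (cut j p z).
Proof.
move=> ij; have skip2_eq w k : k <= i.+1 -> (skip2 i.+2 w == k) = (w == k).
  move=> ki; rewrite -[k in LHS](@skip2_gt i.+2) //.
  by rewrite (inj_eq (@skip2_inj i.+2)).
have open_at k : k <= i.+1 -> open_arc i.+2 p k = skip2 i.+2 (p k).
  by move=> ki; rewrite -[k in LHS](@skip2_gt i.+2) // open_arc_skip.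
rewrite /cut open_arc_skip !skip2_eq ?open_at; try lia.
by do 2?case: ifP.
Qed.

Lemma close_open_lt i j p x : pairing p -> i <= j ->
  close_arc j.+2 (open_arc i p) x = open_arc i (close_arc j p) x.
Proof.
move=> hp ij; apply: (@skip2_inj j.+2).
rewrite skip2_close; last exact: open_pairing.
have e1 : skip2 j.+2 i = i by rewrite skip2_gt //; lia.
have e2 : skip2 j.+2 i.+1 = i.+1 by rewrite skip2_gt //; lia.
case: (skipP i x) => [||z].
- by rewrite /cut e1 !open_arc_fst e2 !ifF //; lia.
- by rewrite /cut e2 !open_arc_snd e1 !ifF //; lia.
rewrite open_arc_skip -(skip2_skip2 z ij) -(skip2_skip2 _ ij) cut_open_lt //.
by rewrite -skip2_close // open_arc_skip.
Qed.

Lemma close_open_gt i j p x : pairing p -> j <= i ->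
  close_arc j (open_arc i.+2 p) x = open_arc i (close_arc j p) x.
Proof.
move=> hp ij; apply: (@skip2_inj j).
rewrite skip2_close; last exact: open_pairing.
have e1 : skip2 j i = i.+2 by rewrite skip2_le.
have e2 : skip2 j i.+1 = i.+3 by rewrite skip2_le //; lia.
case: (skipP i x) => [||z].
- by rewrite /cut e1 !open_arc_fst e2 !ifF //; lia.
- by rewrite /cut e2 !open_arc_snd e1 !ifF //; lia.
rewrite open_arc_skip (skip2_skip2 z ij) (skip2_skip2 _ ij) cut_open_gt //.
by rewrite -skip2_close // open_arc_skip.
Qed.

Lemma close_close i j p x : pairing p -> i <= j ->
  close_arc j (close_arc i p) x = close_arc i (close_arc j.+2 p) x.
Proof.
move=> hp ij; apply: (@skip2_inj j); apply: (@skip2_inj i).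
have hi := close_pairing i hp; have hj := close_pairing j.+2 hp.
rewrite [in RHS]skip2_skip2 // !skip2_close //.
have -> : skip2 i (cut j (close_arc i p) (skip2 j x)) =
    let f := cut i p in let y := skip2 i (skip2 j x) in
    if f y == j.+2 then f j.+3 else if f y == j.+3 then f j.+2 else f y.
  have skip2_eq w k : i <= k -> (skip2 i w == k.+2) = (w == k).
    by move=> ik; rewrite -(@skip2_le i) // (inj_eq (@skip2_inj i)).
  have cut_at k : i <= k -> cut i p k.+2 = skip2 i (close_arc i p k).
    by move=> ik; rewrite skip2_close // (@skip2_le i).
  rewrite /= -(skip2_close i (skip2 j x) hp) !skip2_eq ?cut_at; try lia.
  by rewrite /cut; do 2?case: ifP.
have -> : skip2 j.+2 (cut i (close_arc j.+2 p) (skip2 i x)) =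
    let f := cut j.+2 p in let y := skip2 i (skip2 j x) in
    if f y == i then f i.+1 else if f y == i.+1 then f i else f y.
  have skip2_eq w k : k <= i.+1 -> (skip2 j.+2 w == k) = (w == k).
    move=> ki; rewrite -[k in LHS](@skip2_gt j.+2); last by lia.
    by rewrite (inj_eq (@skip2_inj j.+2)).
  have cut_at k : k <= i.+1 -> cut j.+2 p k = skip2 j.+2 (close_arc j.+2 p k).
    move=> ki; rewrite skip2_close // (@skip2_gt j.+2) //; lia.
  rewrite /= skip2_skip2 // -(skip2_close j.+2 (skip2 i x) hp).
  rewrite !skip2_eq ?cut_at; try lia.
  by rewrite /cut; do 2?case: ifP.
have yi := skip2_neqP i (skip2 j x).
have yj : skip2 i (skip2 j x) <> j.+2 /\ skip2 i (skip2 j x) <> j.+3.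
  by rewrite skip2_skip2 //; exact: skip2_neqP.
move: (skip2 i _) yi yj {hi hj} => y [y1 y2] [y3 y4] /=.
have [i1 i2] := hp i; have [j1 j2] := hp i.+1; have [k1 k2] := hp j.+2.
have [l1 l2] := hp j.+3; have [n1 n2] := hp y.
rewrite /cut.
have d1 : i <> j.+2 by lia.
have d2 : i <> j.+3 by lia.
have d3 : i.+1 <> j.+2 by lia.
have d4 : i.+1 <> j.+3 by lia.
have d5 : i <> i.+1 by lia.
have d6 : j.+2 <> j.+3 by lia.
move: (i.+1) (j.+2) (j.+3) y1 y2 y3 y4 j1 j2 k1 k2 l1 l2 d1 d2 d3 d4 d5 d6.
move=> i' k k' *.
case: (p y =P i) => ?; case: (p y =P i') => ?; try congruence;
  case: (p y =P k) => ?; case: (p y =P k') => ?; try congruence;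
  do ?[case: eqP => ?]; congruence.
Qed.

End Pairings.

(** * The skein module as a representation *)

(** Labels are the ends met along the boundary, the right ends coming first
    from the top, so position [i] on the right is label [i]. *)
Record matching :=
  Matching { partner :> nat -> nat; partnerP : pairing partner }.

Lemma matching_eq (p r : matching) : (forall x, p x = r x) -> p = r.
Proof.
case: p r => [p hp] [r hr] /= /funext e; rewrite e in hp *.
by congr Matching; apply: Prop_irrelevance.
Qed.

Definition mopen i (p : matching) := Matching (open_pairing i (partnerP p)).
Definition mclose i (p : matching) := Matching (close_pairing i (partnerP p)).

Lemma circle_factorE i p : circle_factor i p = (- qint 2) ^+ (p i == i.+1).
Proof. by rewrite /circle_factor; case: eqP. Qed.

Section Model.
Variable N : nat.
Implicit Types v : matching -> web N.

Definition close_op i v : matching -> web N :=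
  fun p => circle_factor i p *: v (mclose i p).
Definition open_op i v : matching -> web N := fun p => v (mopen i p).

Fact close_op_is_linear i : linear (close_op i).
Proof.
move=> c u v; apply/funext => p; rewrite /close_op !fctE.
by rewrite scalerDr !scalerA mulrC.
Qed.
HB.instance Definition _ i :=
  GRing.isLinear.Build Kq (matching -> web N) (matching -> web N) *:%R
    (close_op i) (close_op_is_linear i).

Fact open_op_is_linear i : linear (open_op i).
Proof. by []. Qed.
HB.instance Definition _ i :=
  GRing.isLinear.Build Kq (matching -> web N) (matching -> web N) *:%R
    (open_op i) (open_op_is_linear i).

Lemma open_close_op i v : open_op i (close_op i v) = - qint 2 *: v.
Proof.
apply/funext => p.
rewrite /open_op /close_op /= circle_factorE open_arc_fst eqxx.
by congr (_ *: v _); apply: matching_eq => x; rewrite /= close_open.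
Qed.

Lemma open_closeS_op i v : open_op i (close_op i.+1 v) = v.
Proof.
apply/funext => p; rewrite /open_op /close_op /= circle_factorE open_arc_snd.
rewrite ltn_eqF ?scale1r; last by lia.
by congr v; apply: matching_eq => x; rewrite /= closeS_open.
Qed.

Lemma openS_close_op i v : open_op i.+1 (close_op i v) = v.
Proof.
apply/funext => p; rewrite /open_op /close_op /= circle_factorE.
have -> : (open_arc i.+1 p i == i.+1) = false.
  have e : skip2 i.+1 i = i by rewrite skip2_gt.
  by rewrite -[X in open_arc _ _ X]e open_arc_skip skip2_fst.
rewrite scale1r; congr v; apply: matching_eq => x.
exact: close_openS (partnerP p).
Qed.

Lemma close_close_op i j v :
  (i <= j)%N -> close_op i (close_op j v) = close_op j.+2 (close_op i v).
Proof.
move=> ij; apply/funext => p; rewrite /close_op !scalerA !circle_factorE.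
have hp := partnerP p.
congr (_ *: v _); last by apply: matching_eq => x; apply: close_close.
rewrite -!exprD; congr (_ ^+ _) => /=.
have -> : (close_arc i p j == j.+1) = (cut i p j.+2 == j.+3).
  rewrite -(inj_eq (@skip2_inj i)) skip2_close // !(@skip2_le i) //; lia.
have -> : (close_arc j.+2 p i == i.+1) = (cut j.+2 p i == i.+1).
  rewrite -(inj_eq (@skip2_inj j.+2)) skip2_close // !(@skip2_gt j.+2) //; lia.
have [i1 i2] := hp i; have [j1 j2] := hp i.+1; have [k1 k2] := hp j.+2.
have [l1 l2] := hp j.+3.
rewrite /cut.
have d1 : i <> j.+2 by lia.
have d2 : i <> j.+3 by lia.
have d3 : i.+1 <> j.+2 by lia.
have d4 : i.+1 <> j.+3 by lia.
have d5 : i <> i.+1 by lia.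
have d6 : j.+2 <> j.+3 by lia.
move: (partner p) (i.+1) (j.+2) (j.+3) i1 i2 j1 j2 k1 k2 l1 l2
  d1 d2 d3 d4 d5 d6.
move=> f i' k k' *.
case: (f k =P i) => ?; case: (f k =P i') => ?; case: (f i =P k) => ?;
case: (f i =P k') => ?; try congruence;
do ?[case: eqP => ?]; first [by [] | congruence].
Qed.

Lemma open_open_op i j v :
  (i <= j)%N -> open_op j (open_op i v) = open_op i (open_op j.+2 v).
Proof.
move=> ij; apply/funext => p; rewrite /open_op; congr v.
by apply: matching_eq => x; apply: open_open.
Qed.

Lemma open_close_lt_op i j v :
  (i <= j)%N -> open_op i (close_op j.+2 v) = close_op j (open_op i v).
Proof.
move=> ij; apply/funext => p; rewrite /open_op /close_op !circle_factorE /=.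
congr (_ ^+ (nat_of_bool _) *: v _).
  rewrite -(skip2_le (leqW ij)) -(skip2_le ij) open_arc_skip.
  by rewrite (inj_eq (@skip2_inj i)).
by apply: matching_eq => x; apply: close_open_lt (partnerP p) ij.
Qed.

Lemma open_close_gt_op i j v :
  (j <= i)%N -> open_op i.+2 (close_op j v) = close_op j (open_op i v).
Proof.
move=> ij; apply/funext => p; rewrite /open_op /close_op !circle_factorE /=.
congr (_ ^+ (nat_of_bool _) *: v _).
  have e1 : skip2 i.+2 j = j by rewrite skip2_gt //; lia.
  have e2 : skip2 i.+2 j.+1 = j.+1 by rewrite skip2_gt //; lia.
  by rewrite -{1}e1 -e2 open_arc_skip (inj_eq (@skip2_inj i.+2)) e2.
by apply: matching_eq => x; apply: close_open_gt (partnerP p) ij.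
Qed.

End Model.

(** * Evaluation of diagrams *)

Section Evaluation.
Variables (M : lmodType Kq) (C O : nat -> {linear M -> M}).

Definition act_slice (s : slice) (v : M) : M :=
  match s with
  | Cross d i => (if d then q14 else q14^-1) *: v +
                 (if d then q14^-1 else q14) *: C i (O i v)
  | Close i => C i v
  | Open i => O i v
  end.
Definition act (w : diagram) (v : M) : M := foldr act_slice v w.
Definition act_lincomb (x : lincomb) (v : M) : M :=
  \sum_(s <- x) s.1 *: act s.2 v.

Arguments act : simpl never.

Lemma act_cons s w v : act (s :: w) v = act_slice s (act w v).
Proof. by []. Qed.

Lemma act_cat w1 w2 v : act (w1 ++ w2) v = act w1 (act w2 v).
Proof. exact: foldr_cat. Qed.

Fact act_is_linear w : linear (act w).
Proof.
elim: w => [|s w IH] c u v //; rewrite !act_cons IH.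
case: s => [d i|i|i] /=; [| by rewrite linearP | by rewrite linearP].
have -> : C i (O i (c *: act w u + act w v)) =
    c *: C i (O i (act w u)) + C i (O i (act w v)) by rewrite !linearP.
rewrite !scalerDr !scalerA [X in X *: _ + _ + _]mulrC.
by rewrite [X in _ + (X *: _ + _)]mulrC addrACA.
Qed.
HB.instance Definition _ w :=
  GRing.isLinear.Build Kq M M *:%R (act w) (act_is_linear w).

Lemma act_dg w v : act_lincomb (dg w) v = act w v.
Proof. by rewrite /act_lincomb big_seq1 scale1r. Qed.

Lemma act_lincomb_cat x y v :
  act_lincomb (x ++ y) v = act_lincomb x v + act_lincomb y v.
Proof. exact: big_cat. Qed.

Lemma act_lscale c x v : act_lincomb (lscale c x) v = c *: act_lincomb x v.
Proof.
rewrite /act_lincomb big_map scaler_sumr.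
by apply: eq_bigr => s _; rewrite scalerA.
Qed.

Lemma act_lcomp x y v :
  act_lincomb (lcomp x y) v = act_lincomb x (act_lincomb y v).
Proof.
rewrite /act_lincomb /lcomp big_allpairs_dep; apply: eq_bigr => s _.
rewrite linear_sum scaler_sumr; apply: eq_bigr => r _.
by rewrite act_cat linearZ scalerA.
Qed.

Lemma below_cat d x y : below d (x ++ y) = below d x ++ below d y.
Proof. exact: map_cat. Qed.

Lemma below_lscale d c x : below d (lscale c x) = lscale c (below d x).
Proof. by rewrite /below /lscale -!map_comp. Qed.

Lemma below_lcomp d x y : below d (lcomp x y) = lcomp (below d x) (below d y).
Proof.
rewrite /below /lcomp map_allpairs allpairs_mapl allpairs_mapr.
by apply: eq_allpairs => s r /=; rewrite map_cat.
Qed.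

(** Here the strands above the clasp become a shift of positions, and those
    below disappear from the notation. *)
Lemma act_clasp d n v : act_lincomb (below d (clasp n)) v = jw q14 C O d n v.
Proof.
elim: n v => [|[|n] IH] v; rewrite ?[below _ _]act_dg //; try exact: act_dg.
rewrite jwSS -[clasp n.+2]/(clasp n.+1 ++ lscale (qint n.+1 / qint n.+2)
  (lcomp (clasp n.+1) (lcomp (dg [:: Close n; Open n]) (clasp n.+1)))).
rewrite below_cat below_lscale !below_lcomp act_lincomb_cat act_lscale.
rewrite !act_lcomp.
by rewrite !IH; congr (_ + _ *: jw _ _ _ _ _ _); apply: act_dg.
Qed.

Lemma below0 x : below 0 x = x.
Proof.
rewrite /below -[RHS]map_id; apply: eq_map => -[c w] /=; congr pair.
by rewrite -[RHS]map_id; apply: eq_map => -[].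
Qed.

Lemma act_clasped n w v :
  act_lincomb (clasped n w) v =
  two_jw q14 C O n (act w (two_jw q14 C O n v)).
Proof.
have two u : act_lincomb (two_clasps n) u = two_jw q14 C O n u.
  by rewrite /two_clasps act_lcomp act_clasp -{1}[clasp n]below0 act_clasp.
by rewrite /clasped act_lcomp two act_lcomp act_dg two.
Qed.

Lemma act_crossing i v : act_slice (Cross true i) v = cross q14 C O i v.
Proof. by []. Qed.

(** The lists of positions in a cabled crossing count downwards, from the
    lowest crossing of a row, as the recursion of [up] does. *)
Lemma act_cable_row n h d v : (h <= n)%N ->
  act [seq Cross true ((n + d).-1 - l) | l <- iota (n - h) h] v =
  up q14 C O d h v.
Proof.
elim: h => // h IH hn; rewrite [iota _ _]/= map_cons act_cons -subSn // subSS.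
rewrite IH; last exact: ltnW.
rewrite act_crossing upSr; congr cross; lia.
Qed.

Lemma act_cable_crossing n t d v :
  act [seq Cross true ((n + j).-1 - l) | j <- iota d t, l <- iota 0 n] v =
  twine q14 C O d n t v.
Proof.
elim: t d => // t IH d; rewrite /= act_cat IH.
by rewrite -(act_cable_row d _ (leqnn n)) subnn.
Qed.

Lemma act_twist n m v :
  act (cable n (twist m)) v = iter m (twine q14 C O 0 n n) v.
Proof.
elim: m => // m IH; rewrite iterS -IH -act_cable_crossing -act_cat.
congr (act (_ ++ _) v); rewrite /cable_slice muln0.
by [].
Qed.

Lemma act_turn k j v :
  act (nested_close k j ++ nested_open k j) v = turn C O k j v.
Proof.
rewrite act_cat; have -> : act (nested_open k j) v = opens O k j v.
  elim: j v => // j IH v; rewrite /nested_open -addn1 iotaD map_cat act_cat.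
  by rewrite addn1 IH.
rewrite /turn; elim: j (opens _ _ _ _) => // j IH u.
rewrite /nested_close -[in LHS]addn1 iotaD /= cats1 rev_rcons.
by rewrite map_cons act_cons IH.
Qed.

End Evaluation.

Definition model N : lmodType Kq := (matching -> web N : lmodType Kq).
Definition model_close N : nat -> {linear model N -> model N} :=
  fun i => @close_op N i.
Definition model_open N : nat -> {linear model N -> model N} :=
  fun i => @open_op N i.
Definition mbasis N : model N := fun p => basis N p.

Lemma resolve_cross N d i w p :
  resolve N (Cross d i :: w) p =
  (if d then q14 else q14^-1) *: resolve N w p +
  (if d then q14^-1 else q14) *:
    (circle_factor i p *: resolve N w (open_arc i (close_arc i p))).
Proof. by []. Qed.

Lemma resolve_close N i w p :
  resolve N (Close i :: w) p = circle_factor i p *: resolve N w (close_arc i p).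
Proof. by []. Qed.

Lemma resolve_open N i w p :
  resolve N (Open i :: w) p = resolve N w (open_arc i p).
Proof. by []. Qed.

Lemma act_slice_cross N d i (v : model N) p :
  act_slice (@model_close N) (@model_open N) (Cross d i) v p =
  (if d then q14 else q14^-1) *: v p +
  (if d then q14^-1 else q14) *:
    (circle_factor i p *: v (mopen i (mclose i p))).
Proof. by []. Qed.

Lemma act_slice_close N i (v : model N) p :
  act_slice (@model_close N) (@model_open N) (Close i) v p =
  circle_factor i p *: v (mclose i p).
Proof. by []. Qed.

Lemma act_slice_open N i (v : model N) p :
  act_slice (@model_close N) (@model_open N) (Open i) v p = v (mopen i p).
Proof. by []. Qed.

Lemma resolve_act N w (p : matching) :
  resolve N w p = act (@model_close N) (@model_open N) w (@mbasis N) p.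
Proof.
elim: w p => [|[d i|i|i] w IH] p; first exact: erefl.
- rewrite resolve_cross act_cons act_slice_cross -!IH; reflexivity.
- rewrite resolve_close act_cons act_slice_close -IH; reflexivity.
rewrite resolve_open act_cons act_slice_open -IH; reflexivity.
Qed.

(** A legal diagram consults only the labels of existing ends. *)
Lemma resolve_ext a b w (p p' : nat -> nat) N :
  right_ends a w = Some b ->
  (forall x, (x < a + N)%N -> p x = p' x /\ (p x < a + N)%N) ->
  resolve (b + N) w p = resolve (b + N) w p'.
Proof.
have ext_open c i (r r' : nat -> nat) : (i <= c)%N ->
    (forall x, (x < c)%N -> r x = r' x /\ (r x < c)%N) ->
    forall x, (x < c.+2)%N ->
      open_arc i r x = open_arc i r' x /\ (open_arc i r x < c.+2)%N.
  move=> ic h x xc; case: (skipP i x) xc => [||z] zc.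
  - by rewrite !open_arc_fst; split=> //; lia.
  - by rewrite !open_arc_snd; split=> //; lia.
  have [|e1 e2] := h z; first by move: zc; rewrite /skip2; case: ifP; lia.
  rewrite !open_arc_skip e1 -e1; split=> //.
  by rewrite /skip2; case: ifP; lia.
have ext_close c i (r r' : nat -> nat) : (i.+1 < c.+2)%N ->
    (forall x, (x < c.+2)%N -> r x = r' x /\ (r x < c.+2)%N) ->
    circle_factor i r = circle_factor i r' /\
    forall x, (x < c)%N ->
      close_arc i r x = close_arc i r' x /\ (close_arc i r x < c)%N.
  move=> ic h; have [e1 b1] := h i (ltnW ic); have [e2 b2] := h i.+1 ic.
  split=> [|x xc]; first by rewrite /circle_factor e1.
  have [|e b3] := h (skip2 i x); first by rewrite /skip2; case: ifP; lia.
  rewrite /close_arc -e1 -e2 -e; split=> //.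
  by rewrite /unskip2; do ?case: ifP; lia.
elim: w a p p' => [|[d i|i|i] w IH] a p p' hw h.
- case: hw h => -> h; apply/ffunP => w; rewrite !ffunE.
  congr ((nat_of_bool _)%:R).
  by apply: eq_forallb => x; rewrite (h x _).1.
- have [ia {}hw] : (i.+1 < a)%N /\ right_ends a w = Some b.
    by move: hw => /=; case: ifP.
  have e : (a + N = (a + N).-2.+2)%N by lia.
  rewrite !resolve_cross (IH _ _ _ hw h).
  have [||-> h2] := ext_close (a + N).-2 i p p'; [lia | by rewrite -e |].
  congr (_ + _ *: (_ *: _)); apply: (IH _ _ _ hw) => x; rewrite e => hx.
  by apply: ext_open hx; [lia | exact: h2].
- have [ia {}hw] : (i.+1 < a)%N /\ right_ends a.-2 w = Some b.
    by move: hw => /=; case: ifP.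
  have e : (a + N = (a.-2 + N).+2)%N by lia.
  have [||e1 h2] := ext_close (a.-2 + N)%N i p p'; [lia | by rewrite -e |].
  by rewrite !resolve_close e1 (IH _ _ _ hw h2).
have [ia {}hw] : (i <= a)%N /\ right_ends a.+2 w = Some b.
  by move: hw => /=; case: ifP.
rewrite !resolve_open; apply: (IH _ _ _ hw) => x; rewrite !addSn => hx.
by apply: ext_open hx; [lia | exact: h].
Qed.

(** The identity diagram, extended to all labels by pairing the irrelevant
    ones in consecutive couples; the number of relevant labels is even. *)
Definition through_all (a x : nat) : nat :=
  if (x < a + a)%N then through a x else if odd x then x.-1 else x.+1.

Lemma through_pairing a : pairing (through_all a).
Proof.
move=> x; rewrite /through_all /through; case: ltnP => xa.
  by rewrite ifT; [split; lia | lia].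
case: ifP => ox.
  have xa' : (a + a <= x.-1)%N.
    rewrite leqNgt; apply/negP => h; have e : x = (a + a)%N by lia.
    by rewrite e oddD addbb in ox.
  rewrite ifF; last by lia.
  by rewrite ifF; [split; lia | lia].
rewrite ifF; last by lia.
by rewrite /= ox /=; split; lia.
Qed.

Definition mthrough a := Matching (@through_pairing a).

Lemma bracket_act a b x : legal a b x ->
  bracket a b x =
  act_lincomb (@model_close _) (@model_open _) x (@mbasis (b + a))
    (mthrough a).
Proof.
rewrite /bracket /act_lincomb fct_sumE; elim: x => [|s x IH] /=.
  by rewrite !big_nil.
case/andP=> /eqP hs /IH {}IH; rewrite !big_cons IH; congr (_ + _).
rewrite fctE -resolve_act; congr (_ *: _); apply: (resolve_ext hs) => y ya.
by rewrite /= /through_all ya; split=> //; rewrite /through; lia.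
Qed.

(** * The twist formula *)

Lemma act_F N n m (v : model N) :
  act_lincomb (@model_close N) (@model_open N) (F n m) v =
  \sum_(k : m.-tuple 'I_n.+1 | sorted geq (n :: map val k))
    weight q14 n (map val k) *:
      act_lincomb (@model_close N) (@model_open N) (E n (last n (map val k))) v.
Proof.
rewrite /F act_clasped act_twist.
have := @clasped_twists_sum Kq q14 q14X_neq1 q14_neq0
  (model N) (@model_close N) (@model_open N)
  (@open_close_op N) (@open_closeS_op N) (@openS_close_op N)
  (@close_close_op N) (@open_open_op N) (@open_close_lt_op N)
  (@open_close_gt_op N) m n v.
move=> ->; apply: eq_bigr => k _.
by rewrite /E act_clasped act_turn.
Qed.

Lemma weight_formula n m (k : m.-tuple nat) : sorted geq (n :: k) ->
  weight q14 n k =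
  ((-1) ^+ (m * n) * q14 ^- (m * (n ^ 2 + 2 * n))) *
  ((-1) ^+ (n - last n k) * q12 ^+ (n - last n k)
    * (-1) ^+ (\sum_(i < m) nth 0%N (n :: k) i.+1)
    * q12 ^+ (\sum_(i < m) (nth 0%N (n :: k) i.+1 ^ 2 + nth 0%N (n :: k) i.+1))
    * qmultinom n
        (rcons [seq (nth 0%N (n :: k) i - nth 0%N (n :: k) i.+1)%N
               | i <- iota 0 m] (last n k))).
Proof.
move=> sk; rewrite (weightE q14X_neq1 q14_neq0 sk) size_tuple.
have -> : qmult q14 n (gaps n k) = qmultinom n
        (rcons [seq (nth 0%N (n :: k) i - nth 0%N (n :: k) i.+1)%N
               | i <- iota 0 m] (last n k)).
  by rewrite /gaps size_tuple.
move: (qmultinom _ _) => Q; rewrite /q12 -!exprM.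
rewrite mulnDr !exprD.
move: (\sum_(i < m) _)%N (\sum_(i < m) _)%N => s1 s2.
move: (n - _)%N (m * n)%N (m * _)%N => d mn mm.
move: ((-1) ^+ _) ((-1) ^+ _) ((-1) ^+ _) (q14 ^+ _) (q14 ^+ _) ((q14 ^+ _)^-1).
move=> *; ring.
Qed.

Theorem proposition3p5 (n m : nat) :
  bracket (n + n) (n + n) (F n m) =
  ((-1) ^+ (m * n) * q14 ^- (m * (n ^ 2 + 2 * n))) *:
  \sum_(k : m.-tuple 'I_n.+1 | sorted geq (n :: map val k))
    (let ks := n :: map val k in
     let km := last n (map val k) in
     ((-1) ^+ (n - km) * q12 ^+ (n - km)
      * (-1) ^+ (\sum_(i < m) nth 0%N ks i.+1)
      * q12 ^+ (\sum_(i < m) (nth 0%N ks i.+1 ^ 2 + nth 0%N ks i.+1))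
      * qmultinom n
          (rcons [seq (nth 0%N ks i - nth 0%N ks i.+1)%N | i <- iota 0 m] km))
     *: bracket (n + n) (n + n) (E n km)).
Proof.
rewrite (bracket_act (legal_F n m)) act_F fct_sumE scaler_sumr.
apply: eq_bigr => k sk; cbv zeta.
have kn : (last n (map val k) <= n)%N by apply: sorted_geq_last.
rewrite (bracket_act (legal_E kn)) scalerA.
by rewrite -(weight_formula (k := [tuple of map val k]) sk) fctE.
Qed.
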